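(* There exists a polynomial function $C$ with positive coefficients such that the following holds. Let $n\geq 1$ be an integer and $A_1,\dots,A_n\in SL(d,\mathbb{Z})$. Suppose that there exist $\beta\in(0,1)$, $D_n>0$, $\Delta_n>0$ such that $\Delta_n<\frac12 n^\beta$ and $\mathcal{S}(D_n,\Delta_n)$ is satisfied by $(A_1,\dots,A_n)$. Let $g_n$ be a real trigonometric polynomial on $\mathbb{T}^d$ with zero mean and $\hat g_n(p)=0$ for $\|p\|>D_n$, let $S_n(t)=\sum_{\ell=1}^n g_n(\tau_\ell\cdots\tau_1t)$, and assume $\|S_n\|_2>0$. Then for every $x\in\mathbb{R}$ with $|x|\,\|g_n\|_\infty n^\beta\le\|S_n\|_2$ and $|x|\,\|g_n\|_\infty^{1/2}n^{\frac{1+3\beta}{4}}\le\|S_n\|_2$: $$\Big|\mathbb{E}\big[e^{ix\frac{S_n}{\|S_n\|_2}}\big]-e^{-\frac12x^2}\Big|\le C(\|g_n\|_\infty^{1/2})\Big[|x|\,\|S_n\|_2^{-1}\Delta_n n^{\frac{1-\beta}{2}}+|x|^3\|S_n\|_2^{-3}n^{1+2\beta}+|x|\,\|S_n\|_2^{-1}n^{\frac{1+3\beta}{4}}+|x|^2\|S_n\|_2^{-1}n^{\frac{1-\beta}{2}}\Delta_n+|x|^2\|S_n\|_2^{-2}n^{1-\beta}\Delta_n^2\Big].$$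
   Context: $d\ge2$, $\mathbb{T}^d=\mathbb{R}^d/\mathbb{Z}^d$ with Lebesgue measure $\lambda$; $\mathbb{E}$ is integration with respect to $\lambda$ and $\|\cdot\|_2$ the $L^2(\lambda)$ norm. $\hat g(p)$, $p\in\mathbb{Z}^d$, are Fourier coefficients with respect to the characters $t\mapsto e^{2\pi i\langle p,t\rangle}$. $\|x\|=\max_i|x_i|$ on $\mathbb{R}^d$. $\tau_k$ is the torus automorphism $t\mapsto A_k^t t\bmod1$ (transposed matrix). For $i\le j$, $A_i^j=A_i\cdots A_j$. The property $\mathcal{S}(D,\Delta)$ is satisfied by $(A_1,\dots,A_n)$ if: for every integer $s\ge1$, every increasing sequence of $2s$ integers $1\le\ell_1\le\ell_1'\le\ell_2\le\ell_2'\le\dots\le\ell_s\le\ell_s'\le n$ with $\ell_{j+1}\ge\ell_j'+\Delta$ for $j=1,\dots,s-1$, and all $p_1,\dots,p_s,p_1',\dots,p_s'\in\mathbb{Z}^d$ such that $A_1^{\ell_s'}p_s'+A_1^{\ell_s}p_s\ne0$ and $\|p_j\|,\|p_j'\|\le D$ for all $j$, one has $\sum_{j=1}^s[A_1^{\ell_j'}p_j'+A_1^{\ell_j}p_j]\ne0$. *)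

(* Defs.v *)
From HB Require Import structures.
From mathcomp Require Import all_boot all_order all_algebra.
From mathcomp Require Import all_classical all_reals all_analysis.
From mathcomp Require Import measurable_realfun lebesgue_measure.
From mathcomp Require Import complex.

Set Implicit Arguments.
Unset Strict Implicit.
Unset Printing Implicit Defensive.

Import Order.TTheory GRing.Theory Num.Theory.
Import numFieldNormedType.Exports.

Local Open Scope classical_set_scope.
Local Open Scope ring_scope.

(* Points of T^d = R^d/Z^d are given by representatives in R^d, here
   [d.-tuple R], which carries the product sigma-algebra. Functions on T^d are
   Z^d-periodic functions on R^d, integrated over the cube [0,1]^d. *)

Section torus_measure.
Variable R : realType.

Definition tuple_cons (d : nat) (u : measurableTypeR R * d.-tuple R) : d.+1.-tuple R :=
  [the d.+1.-tuple R of u.1 :: u.2].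

Lemma measurable_tuple_cons (d : nat) :
  measurable_fun [set: measurableTypeR R * d.-tuple R] (@tuple_cons d).
Proof. by apply: measurable_cons. Qed.

HB.instance Definition _ (d : nat) :=
  isMeasurableFun.Build _ _ _ _ (@tuple_cons d) (@measurable_tuple_cons d).

(* Lebesgue measure on [0,1]^d, as the d-fold product of Lebesgue measure on
   [0,1]. *)
Fixpoint torus_measure (d : nat) : probability (d.-tuple R) R :=
  match d return probability (d.-tuple R) R with
  | 0 => \d_ [tuple]
  | d'.+1 => distribution (uniform_prob (@ltr01 R) \x torus_measure d')%E
                          (@tuple_cons d')
  end.

Definition sup_norm (d : nat) (f : d.-tuple R -> R) : R :=
  sup [set `|f t| | t in [set: d.-tuple R]].

Definition L2_norm (d : nat) (f : d.-tuple R -> R) : R :=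
  fine ('N[torus_measure d]_2%:E [EFin \o f])%E.

Definition cexpectation (d : nat) (f : d.-tuple R -> R[i]) : R[i] :=
  Complex (\int[torus_measure d]_t complex.Re (f t))
          (\int[torus_measure d]_t complex.Im (f t)).

End torus_measure.

Section trigonometric.
Variable R : realType.

(* e^{i theta} *)
Definition expi (theta : R) : R[i] := Complex (cos theta) (sin theta).

Definition dotZ (d : nat) (p : 'cV[int]_d) (t : d.-tuple R) : R :=
  \sum_(i < d) (p i ord0)%:~R * tnth t i.

Definition character (d : nat) (p : 'cV[int]_d) (t : d.-tuple R) : R[i] :=
  expi (2 * pi * dotZ p t).

Definition fourier_coef (d : nat) (g : d.-tuple R -> R) (p : 'cV[int]_d)
    : R[i] :=
  cexpectation (fun t => (g t)%:C%C * ((character p t)^*)%C).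

Definition real_trig_poly (d : nat) (g : d.-tuple R -> R) : Prop :=
  exists (s : seq 'cV[int]_d) (c : 'cV[int]_d -> R[i]),
    forall t, (g t)%:C%C = \sum_(p <- s) c p * character p t.

End trigonometric.

Section automorphisms.
Variable R : realType.

Definition max_norm (d : nat) (p : 'cV[int]_d) : nat :=
  \max_(i < d) `|p i ord0|%N.

(* A_i^j = A_i A_{i+1} ... A_j *)
Definition mxprod (d : nat) (A : nat -> 'M[int]_d) (i j : nat) : 'M[int]_d :=
  \big[mulmx/1%:M]_(i <= k < j.+1) A k.

Definition mod1 (x : R) : R := x - (Num.floor x)%:~R.

(* t |-> B^T t mod 1 *)
Definition torus_map (d : nat) (B : 'M[int]_d) (t : d.-tuple R) : d.-tuple R :=
  [tuple mod1 (\sum_(j < d) (B^T i j)%:~R * tnth t j) | i < d].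

(* tau_l (... (tau_1 t)), where tau_k is the automorphism given by A k *)
Fixpoint torus_orbit (d : nat) (A : nat -> 'M[int]_d) (l : nat)
    (t : d.-tuple R) : d.-tuple R :=
  match l with
  | 0 => t
  | l'.+1 => torus_map (A l'.+1) (torus_orbit A l' t)
  end.

Definition birkhoff_sum (d : nat) (A : nat -> 'M[int]_d)
    (g : d.-tuple R -> R) (n : nat) (t : d.-tuple R) : R :=
  \sum_(1 <= l < n.+1) g (torus_orbit A l t).

(* The property S(D, Delta) for (A_1, ..., A_n); the sequences l, l', p, p'
   are indexed by 1, ..., s, their other values being irrelevant. *)
Definition propS (d n : nat) (A : nat -> 'M[int]_d) (D Delta : R) : Prop :=
  forall (s : nat) (l l' : nat -> nat) (p p' : nat -> 'cV[int]_d),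
    (1 <= s)%N ->
    (forall j, (1 <= j <= s)%N -> (1 <= l j <= l' j)%N /\ (l' j <= n)%N) ->
    (forall j, (1 <= j < s)%N -> (l' j <= l j.+1)%N) ->
    (forall j, (1 <= j < s)%N -> (l' j)%:R + Delta <= (l j.+1)%:R) ->
    mxprod A 1 (l' s) *m p' s + mxprod A 1 (l s) *m p s != 0 ->
    (forall j, (1 <= j <= s)%N ->
       (max_norm (p j))%:R <= D /\ (max_norm (p' j))%:R <= D) ->
    \sum_(1 <= j < s.+1)
       (mxprod A 1 (l' j) *m p' j + mxprod A 1 (l j) *m p j) != 0.

End automorphisms.

(* Main.v *)
Require Import Defs.
From HB Require Import structures.
From mathcomp Require Import all_boot all_order all_algebra.
From mathcomp Require Import all_classical all_reals all_analysis.
From mathcomp Require Import measurable_realfun lebesgue_measure.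
From mathcomp Require Import complex.
From mathcomp Require Import ring lra zify.

(** The summands g(tau_l ... tau_1 t) are trigonometric polynomials with
    frequencies A_1^l p. Cut [1, n] into periods of length P = floor(n^beta), each
    but the last consisting of a block followed by a gap of length floor(Delta);
    the last, possibly shorter, period is a block. Let T_k be the sum over the k-th
    block, W the sum over all gaps, N = ||S_n||_2 and y_k = x T_k / N.

    The hypothesis S(D, Delta) says that a nonzero frequency A_1^l p + A_1^l' p'
    from one block is not cancelled by such frequencies from the earlier blocks
    ([lacunary_blocks]). Hence a product of linear combinations of 1, T_k and
    T_k^2, one for each k, has as mean the product of the means
    ([cexpectation_lacunary_prod]), as if the blocks were independent; the same
    holds for the gaps. Consequences, with V = sum y_k^2, v = E V and
    Q = prod (1 + i y_k):
    - E Q = 1 and E |Q|^2 = prod (1 + E y_k^2) <= e^v;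
    - Var V <= sum E y_k^4;
    - E W^2 is the sum of the second moments of the gap sums.

    Since e^(iy) = (1 + iy) e^(-y^2/2) + O(|y|^3) with both sides of modulus at
    most 1, the product e^(i sum y_k) equals Q e^(-V/2) up to O(sum |y_k|^3).
    Replacing V by v changes the mean by O(||V - v||_2), because |Q| <= e^(V/2)
    and |Q| e^(-v/2) has L^2 norm at most 1, and E Q e^(-v/2) = e^(-v/2)
    ([lacunary_characteristic_function]). Finally W is small in L^2, so that
    x S_n / N differs little from sum y_k and v differs little from x^2
    ([block_characteristic_bound]). There are O(n^(1-beta)) blocks, of length at
    most n^beta each, and inserting this gives the stated rates
    ([final_bound]). *)

Set Implicit Arguments.
Unset Strict Implicit.
Unset Printing Implicit Defensive.

Import Order.TTheory GRing.Theory Num.Theory.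
Import numFieldNormedType.Exports.

Local Open Scope classical_set_scope.
Local Open Scope ring_scope.

(** * Bounded measurable functions and their expectation *)

Section bounded_measurable.
Context d (T : measurableType d) (R : realType).
Implicit Types f g : T -> R.

Definition bmeas f := measurable_fun setT f /\ exists M, forall t, `|f t| <= M.

Lemma bmeas_cst a : bmeas (fun=> a).
Proof. by split; [exact: measurable_cst|exists `|a|]. Qed.

Lemma bmeasD f g : bmeas f -> bmeas g -> bmeas (fun t => f t + g t).
Proof.
move=> [mf [M hM]] [mg [N hN]]; split; first exact: measurable_funD.
by exists (M + N) => t; rewrite (le_trans (ler_normD _ _))// lerD.
Qed.

Lemma bmeasM f g : bmeas f -> bmeas g -> bmeas (fun t => f t * g t).
Proof.
move=> [mf [M hM]] [mg [N hN]]; split; first exact: measurable_funM.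
by exists (M * N) => t; rewrite normrM ler_pM.
Qed.

Lemma bmeasZ a f : bmeas f -> bmeas (fun t => a * f t).
Proof. by move=> hf; apply: bmeasM => //; exact: bmeas_cst. Qed.

Lemma bmeasN f : bmeas f -> bmeas (fun t => - f t).
Proof.
move=> hf; rewrite (_ : (fun t => - f t) = fun t => -1 * f t); first exact: bmeasZ.
by apply/funext => t; rewrite mulN1r.
Qed.

Lemma bmeasB f g : bmeas f -> bmeas g -> bmeas (fun t => f t - g t).
Proof. by move=> hf hg; apply: bmeasD => //; exact: bmeasN. Qed.

Lemma bmeasX f k : bmeas f -> bmeas (fun t => f t ^+ k).
Proof.
move=> hf; elim: k => [|k ih]; first exact: bmeas_cst.
under eq_fun do rewrite exprS; exact: bmeasM.
Qed.

Lemma bmeas_sum (I : Type) (r : seq I) (P : pred I) (F : I -> T -> R) :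
  (forall i, P i -> bmeas (F i)) -> bmeas (fun t => \sum_(i <- r | P i) F i t).
Proof.
move=> hF; elim: r => [|i r ih].
  under eq_fun do rewrite big_nil; exact: bmeas_cst.
under eq_fun do rewrite big_cons.
by have [Pi|//] := boolP (P i); apply: bmeasD => //; exact: hF.
Qed.

Lemma bmeas_norm f : bmeas f -> bmeas (fun t => `|f t|).
Proof.
move=> [mf [M hM]]; split; first exact: measurableT_comp.
by exists M => t; rewrite normr_id.
Qed.

Lemma bmeas_cos f : measurable_fun setT f -> bmeas (fun t => cos (f t)).
Proof.
move=> mf; split.
  by apply: measurableT_comp => //; apply: continuous_measurable_fun => x;
    exact: continuous_cos.
by exists 1 => t; exact: cos_max.
Qed.

Lemma bmeas_sin f : measurable_fun setT f -> bmeas (fun t => sin (f t)).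
Proof.
move=> mf; split.
  by apply: measurableT_comp => //; apply: continuous_measurable_fun => x;
    exact: continuous_sin.
by exists 1 => t; exact: sin_max.
Qed.

Lemma bmeas_expR f : bmeas f -> bmeas (fun t => expR (f t)).
Proof.
move=> [mf [M hM]]; split; first exact: measurableT_comp.
exists (expR M) => t; rewrite ger0_norm ?expR_ge0// ler_expR.
exact: le_trans (ler_norm _) _.
Qed.

Variable P : probability T R.

Local Notation "\E f" := (\int[P]_t f t) (at level 10).

Lemma bmeas_integrable f : bmeas f -> P.-integrable setT (EFin \o f).
Proof.
move=> [mf [M hM]]; apply: measurable_bounded_integrable => //.
  exact: le_lt_trans (probability_le1 P measurableT) (ltry 1).
exists M; split; first by rewrite num_real.
by move=> x Mx t _ /=; exact: le_trans (hM t) (ltW Mx).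
Qed.

Lemma expect_cst a : \int[P]_t a = a.
Proof.
rewrite Rintegral_cst// [fine _](_ : _ = 1) ?mulr1//.
exact: congr1 (probability_setT P).
Qed.

Lemma expectD f g : bmeas f -> bmeas g ->
  \int[P]_t (f t + g t) = \E f + \E g.
Proof. by move=> hf hg; apply: RintegralD => //; exact: bmeas_integrable. Qed.

Lemma expectB f g : bmeas f -> bmeas g ->
  \int[P]_t (f t - g t) = \E f - \E g.
Proof. by move=> hf hg; apply: RintegralB => //; exact: bmeas_integrable. Qed.

Lemma expectZ a f : bmeas f -> \int[P]_t (a * f t) = a * \E f.
Proof. by move=> hf; apply: RintegralZl => //; exact: bmeas_integrable. Qed.

Lemma expect_sum (I : Type) (r : seq I) (F : I -> T -> R) :
  (forall i, bmeas (F i)) ->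
  \int[P]_t (\sum_(i <- r) F i t) = \sum_(i <- r) \E (F i).
Proof.
move=> hF; elim: r => [|i r ih].
  by under eq_Rintegral do rewrite big_nil; rewrite expect_cst big_nil.
under eq_Rintegral do rewrite big_cons.
by rewrite big_cons -ih expectD//; exact: bmeas_sum.
Qed.

Lemma expect_le f g : bmeas f -> bmeas g -> (forall t, f t <= g t) -> \E f <= \E g.
Proof. by move=> hf hg fg; apply: le_Rintegral => //; exact: bmeas_integrable. Qed.

Lemma expect_norm f : bmeas f -> `|\E f| <= \int[P]_t `|f t|.
Proof. by move=> hf; apply: le_normr_Rintegral => //; exact: bmeas_integrable. Qed.

(** Integrate the pointwise bound 2|fg| <= c f^2 + g^2 / c with
    c = (r + e) / (s + e); taking e > 0 small covers the degenerate case s = 0,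
    in which the optimal ratio r / s does not exist. *)
Lemma expect_CauchySchwarz f g (s r : R) : bmeas f -> bmeas g -> 0 <= s -> 0 <= r ->
  \int[P]_t (f t ^+ 2) <= s ^+ 2 -> \int[P]_t (g t ^+ 2) <= r ^+ 2 ->
  \int[P]_t `|f t * g t| <= s * r.
Proof.
move=> hf hg s0 r0 hs hr.
suff H : forall e, 0 < e -> \int[P]_t `|f t * g t| <= (s + e) * (r + e).
  apply/ler_addgt0Pr => e e0.
  have k0 : 0 < s + r + 1 by lra.
  pose e' := Num.min 1 (e / (s + r + 1)).
  have e'0 : 0 < e' by rewrite lt_min ltr01 divr_gt0.
  apply: le_trans (H _ e'0) _.
  have e'1 : e' <= 1 by rewrite ge_min lexx.
  have e'2 : e' * (s + r + 1) <= e by rewrite -ler_pdivlMr// ge_min lexx orbT.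
  have : e' * e' <= e' * 1 by rewrite ler_pM2l.
  nra.
move=> e e0; have se : 0 < s + e by lra.
have re : 0 < r + e by lra.
pose c := (r + e) / (s + e); have c0 : 0 < c by rewrite divr_gt0.
apply: (@le_trans _ _ (\int[P]_t (c / 2 * f t ^+ 2 + c^-1 / 2 * g t ^+ 2))).
  apply: expect_le => [||t].
  - exact/bmeas_norm/bmeasM.
  - by apply: bmeasD; apply: bmeasZ; exact: bmeasX.
  - rewrite normrM -(real_normK (num_real (f t))) -(real_normK (num_real (g t))).
    set a := `|f t|; set b := `|g t|.
    have : 0 <= (c * a - b) ^+ 2 * (c^-1 / 2).
      by rewrite mulr_ge0 ?sqr_ge0// divr_ge0// invr_ge0 ltW.
    suff -> : (c * a - b) ^+ 2 * (c^-1 / 2) =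
      c / 2 * a ^+ 2 + c^-1 / 2 * b ^+ 2 - a * b by rewrite subr_ge0.
    by field; rewrite gt_eqF.
rewrite expectD ?expectZ; try by [apply: bmeasZ; exact: bmeasX|exact: bmeasX].
have -> : (s + e) * (r + e) = c / 2 * (s + e) ^+ 2 + c^-1 / 2 * (r + e) ^+ 2.
  by rewrite /c; field; rewrite !gt_eqF.
have sqe (z : R) : 0 <= z -> z ^+ 2 <= (z + e) ^+ 2 by move=> z0; nra.
apply: lerD; apply: ler_wpM2l; rewrite ?divr_ge0 ?invr_ge0 ?(ltW c0) ?(ltW re) ?(ltW se)//.
- exact: le_trans hs (sqe _ s0).
- exact: le_trans hr (sqe _ r0).
Qed.

End bounded_measurable.

(** * Complex expectations and Fourier orthogonality *)

Section complex_expectation.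
Variable R : realType.
Local Notation Re := (@complex.Re R).
Local Notation Im := (@complex.Im R).
Local Notation normc := (@ComplexField.Normc.normc R).

Lemma ReM (x y : R[i]) : Re (x * y) = Re x * Re y - Im x * Im y.
Proof. by case: x; case: y. Qed.

Lemma ImM (x y : R[i]) : Im (x * y) = Re x * Im y + Im x * Re y.
Proof. by case: x; case: y. Qed.

Lemma complex_eq (x y : R[i]) : Re x = Re y -> Im x = Im y -> x = y.
Proof. by case: x y => a b [c e] /= -> ->. Qed.

Lemma ReD (x y : R[i]) : Re (x + y) = Re x + Re y.
Proof. by case: x; case: y. Qed.

Lemma ImD (x y : R[i]) : Im (x + y) = Im x + Im y.
Proof. by case: x; case: y. Qed.

Lemma Re_le_normc (z : R[i]) : `|Re z| <= normc z.
Proof.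
case: z => a b /=; rewrite -sqrtr_sqr ler_wsqrtr// lerDl; exact: sqr_ge0.
Qed.

Lemma Im_le_normc (z : R[i]) : `|Im z| <= normc z.
Proof.
case: z => a b /=; rewrite -sqrtr_sqr ler_wsqrtr// lerDr; exact: sqr_ge0.
Qed.

Lemma normc_le_ReIm (z : R[i]) : normc z <= `|Re z| + `|Im z|.
Proof.
case: z => a b /=; rewrite -[leRHS]ger0_norm ?addr_ge0// -sqrtr_sqr ler_wsqrtr//.
rewrite -(real_normK (num_real a)) -(real_normK (num_real b)).
have := mulr_ge0 (normr_ge0 a) (normr_ge0 b); nra.
Qed.

Lemma normc_ge0 (z : R[i]) : 0 <= normc z.
Proof. exact: le_trans (Re_le_normc z). Qed.

Lemma normc_real (a : R) : normc a%:C%C = `|a|.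
Proof. by rewrite /= expr0n/= addr0 sqrtr_sqr. Qed.

Lemma normc_expi (a : R) : normc (expi a) = 1.
Proof. by rewrite /= cos2Dsin2 sqrtr1. Qed.

Lemma expiD (a b : R) : expi (a + b) = expi a * expi b.
Proof.
apply: complex_eq => /=; first by rewrite cosD.
by rewrite sinD addrC [X in _ = X]addrC addrC.
Qed.

Lemma expi0 : expi (0 : R) = 1.
Proof. by rewrite /expi cos0 sin0. Qed.

Lemma expiN (a : R) : expi (- a) = ((expi a)^*)%C.
Proof. by rewrite /expi cosN sinN. Qed.

Variable d : nat.
Local Notation mu := (torus_measure R d).
Implicit Types F G : d.-tuple R -> R[i].

Definition cbmeas F := bmeas (fun t => Re (F t)) /\ bmeas (fun t => Im (F t)).

Lemma cbmeas_cst a : cbmeas (fun=> a).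
Proof. by split; exact: bmeas_cst. Qed.

Lemma cbmeasD F G : cbmeas F -> cbmeas G -> cbmeas (fun t => F t + G t).
Proof.
move=> [? ?] [? ?]; split.
- by under eq_fun do rewrite ReD; exact: bmeasD.
- by under eq_fun do rewrite ImD; exact: bmeasD.
Qed.

Lemma cbmeasM F G : cbmeas F -> cbmeas G -> cbmeas (fun t => F t * G t).
Proof.
move=> [? ?] [? ?]; split.
- by under eq_fun do rewrite ReM; apply: bmeasB; exact: bmeasM.
- by under eq_fun do rewrite ImM; apply: bmeasD; exact: bmeasM.
Qed.

Lemma cbmeas_real (f : d.-tuple R -> R) : bmeas f -> cbmeas (fun t => (f t)%:C%C).
Proof. by move=> hf; split => //=; exact: bmeas_cst. Qed.

Lemma cbmeasB F G : cbmeas F -> cbmeas G -> cbmeas (fun t => F t - G t).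
Proof.
move=> hF hG; rewrite (_ : (fun t => _) = fun t => F t + (-1) * G t).
  by apply: cbmeasD => //; apply: cbmeasM => //; exact: cbmeas_cst.
by apply/funext => t; rewrite mulN1r.
Qed.

Lemma cbmeas_sum (I : Type) (r : seq I) (F : I -> d.-tuple R -> R[i]) :
  (forall i, cbmeas (F i)) -> cbmeas (fun t => \sum_(i <- r) F i t).
Proof.
move=> hF; elim: r => [|i r ih].
  by under eq_fun do rewrite big_nil; exact: cbmeas_cst.
by under eq_fun do rewrite big_cons; exact: cbmeasD.
Qed.

Lemma cbmeas_prod (I : Type) (r : seq I) (F : I -> d.-tuple R -> R[i]) :
  (forall i, cbmeas (F i)) -> cbmeas (fun t => \prod_(i <- r) F i t).
Proof.
move=> hF; elim: r => [|i r ih].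
  by under eq_fun do rewrite big_nil; exact: cbmeas_cst.
by under eq_fun do rewrite big_cons; exact: cbmeasM.
Qed.

Lemma cbmeas_expi (f : d.-tuple R -> R) :
  measurable_fun setT f -> cbmeas (fun t => expi (f t)).
Proof. by move=> mf; split; [exact: bmeas_cos|exact: bmeas_sin]. Qed.

Lemma cexpectation_cst a : @cexpectation R d (fun=> a) = a.
Proof. by apply: complex_eq; rewrite /= expect_cst. Qed.

Lemma cexpectation_real (f : d.-tuple R -> R) :
  cexpectation (fun t => (f t)%:C%C) = (\int[mu]_t f t)%:C%C.
Proof. by apply: complex_eq; rewrite //= expect_cst. Qed.

Lemma cexpectationD F G : cbmeas F -> cbmeas G ->
  cexpectation (fun t => F t + G t) = cexpectation F + cexpectation G.
Proof.
move=> [? ?] [? ?]; apply: complex_eq => /=.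
- by under eq_Rintegral do rewrite ReD; rewrite expectD.
- by under eq_Rintegral do rewrite ImD; rewrite expectD.
Qed.

Lemma cexpectationZ a F : cbmeas F ->
  cexpectation (fun t => a * F t) = a * cexpectation F.
Proof.
move=> [? ?]; apply: complex_eq => /=.
- under eq_Rintegral do rewrite ReM.
  rewrite expectB ?expectZ//; try exact: bmeasZ.
  by case: a.
- under eq_Rintegral do rewrite ImM.
  rewrite expectD ?expectZ//; try exact: bmeasZ.
  by case: a.
Qed.

Lemma cexpectationB F G : cbmeas F -> cbmeas G ->
  cexpectation (fun t => F t - G t) = cexpectation F - cexpectation G.
Proof.
move=> hF hG; rewrite -[- cexpectation G]mulN1r -cexpectationZ// -cexpectationD//.
  by congr cexpectation; apply/funext => t; rewrite mulN1r.
by apply: cbmeasM => //; exact: cbmeas_cst.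
Qed.

Lemma cexpectation_sum (I : Type) (r : seq I) (F : I -> d.-tuple R -> R[i]) :
  (forall i, cbmeas (F i)) ->
  cexpectation (fun t => \sum_(i <- r) F i t) = \sum_(i <- r) cexpectation (F i).
Proof.
move=> hF; elim: r => [|i r ih].
  under [fun t => _]eq_fun do rewrite big_nil.
  by rewrite cexpectation_cst big_nil.
under [fun t => _]eq_fun do rewrite big_cons.
by rewrite big_cons -ih cexpectationD//; exact: cbmeas_sum.
Qed.

(** The factor 2 is the price for treating real and imaginary part separately. *)
Lemma normc_cexpectation_le F (h : d.-tuple R -> R) : cbmeas F -> bmeas h ->
  (forall t, normc (F t) <= h t) -> normc (cexpectation F) <= 2 * \int[mu]_t h t.
Proof.
move=> [hR hI] hh Fh; rewrite (le_trans (normc_le_ReIm _))//= mulr2n mulrDl mul1r.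
apply: lerD; apply: (le_trans (expect_norm _ _)) => //;
  apply: expect_le => //; try exact: bmeas_norm; move=> t; apply: le_trans (Fh t).
- exact: Re_le_normc.
- exact: Im_le_normc.
Qed.

End complex_expectation.

Section torus_norms.
Variable R : realType.

Lemma L2_norm_sqr d (f : d.-tuple R -> R) : bmeas f ->
  L2_norm f ^+ 2 = \int[torus_measure R d]_t (f t ^+ 2).
Proof.
move=> hf; have hf2 := bmeasX 2 hf.
have If : (\int[torus_measure R d]_t ((f t ^+ 2)%:E))%E \is a fin_num.
  apply: integrable_fin_num => //; exact: bmeas_integrable hf2.
rewrite /L2_norm unlock /=.
rewrite (_ : (\int[_]_x _)%E = (\int[torus_measure R d]_t ((f t ^+ 2)%:E))%E); last first.
  apply: eq_integral => t _ /=.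
  by rewrite powR_mulrn// real_normK// num_real.
rewrite -(fineK If) /= -powR_mulrn ?powR_ge0// -powRrM mulVf// powRr1//.
by apply: Rintegral_ge0 => t _; exact: sqr_ge0.
Qed.

Lemma normr_le_sup_norm d (f : d.-tuple R -> R) (t : d.-tuple R) : bmeas f ->
  `|f t| <= sup_norm f.
Proof.
move=> [_ [M hM]]; apply: ub_le_sup; last by exists t.
by exists M => _ [s _ <-].
Qed.

End torus_norms.

Section characters.
Variable R : realType.

Lemma dotZD d (p q : 'cV[int]_d) (t : d.-tuple R) :
  dotZ (p + q) t = dotZ p t + dotZ q t.
Proof.
rewrite /dotZ -big_split/=; apply: eq_bigr => i _.
by rewrite mxE intrD mulrDl.
Qed.

Lemma characterD d (p q : 'cV[int]_d) (t : d.-tuple R) :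
  character (p + q) t = character p t * character q t.
Proof. by rewrite /character dotZD mulrDr expiD. Qed.

Lemma character0 d (t : d.-tuple R) : character 0 t = 1.
Proof.
rewrite /character /dotZ big1 ?mulr0 ?expi0// => i _.
by rewrite mxE mul0r.
Qed.

Lemma characterN d (p : 'cV[int]_d) (t : d.-tuple R) :
  character (- p) t = ((character p t)^*)%C.
Proof.
rewrite /character -expiN -mulrN; congr (expi (_ * _)).
by rewrite /dotZ -sumrN; apply: eq_bigr => i _; rewrite mxE intrN mulNr.
Qed.

Lemma measurable_dotZ d (p : 'cV[int]_d) :
  measurable_fun setT (@dotZ R d p).
Proof.
apply: measurable_sum => i; apply: measurable_funM => //.
exact: measurable_tnth.
Qed.

Lemma cbmeas_character d (p : 'cV[int]_d) : cbmeas (@character R d p).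
Proof. by apply: cbmeas_expi; apply: measurable_funM => //; exact: measurable_dotZ. Qed.

Local Notation U := (uniform_prob (@ltr01 R)).

(** Adding a bound of f to f reduces to a nonnegative integrand, for which the
    integral against the uniform density is an integral over [0, 1]. *)
Lemma expect_uniform (f : R -> R) : bmeas (f : measurableTypeR R -> R) ->
  \int[U]_x f x = \int[lebesgue_measure]_(x in `[0, 1]) f x.
Proof.
move=> hf; have [mf [M hM]] := hf.
have hfM : bmeas ((fun x => f x + M) : measurableTypeR R -> R).
  by apply: bmeasD => //; exact: bmeas_cst.
have f0 x : 0 <= f x + M by have := hM x; rewrite ler_norml; lra.
have lf : lebesgue_measure.-integrable `[0, 1] (EFin \o f).
  apply: measurable_bounded_integrable => //.
  - by rewrite /= lebesgue_measure_itv/= lte_fin ltr01 oppr0 adde0 ltry.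
  - exact: measurable_funTS.
  - exists M; split; first by rewrite num_real.
    by move=> x Mx t _ /=; exact: le_trans (hM t) (ltW Mx).
have := expectD U hf (bmeas_cst _ M); rewrite expect_cst => e.
have : \int[U]_x (f x + M) = \int[lebesgue_measure]_(x in `[0, 1]) (f x + M).
  rewrite /Rintegral (integral_uniform ltr01).
  - by rewrite subr0 invr1 mul1e.
  - by apply/measurable_EFinP; case: hfM.
  - by move=> x; rewrite lee_fin.
rewrite e RintegralD//; last first.
  apply: measurable_bounded_integrable => //.
  - by rewrite /= lebesgue_measure_itv/= lte_fin ltr01 oppr0 adde0 ltry.
  - exists `|M|; split; first by rewrite num_real.
    by move=> x Mx t _ /=; exact: ltW.
rewrite [X in _ = _ + X -> _]Rintegral_cst//= lebesgue_measure_itv/= lte_fin ltr01.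
by rewrite oppr0 adde0/= mulr1 => /addIr.
Qed.

Lemma expi_2pi_nat (n : nat) : expi (2 * pi * n%:R : R) = 1.
Proof.
have -> : 2 * pi * n%:R = 0 + (pi *+ 2) *+ n :> R.
  by rewrite add0r -[RHS]mulr_natr -[pi *+ 2]mulr_natr [pi * 2]mulrC.
by rewrite /expi (periodicn (@cosD2pi R)) (periodicn (@sinD2pi R)) cos0 sin0.
Qed.

Lemma expi_2pi_int (k : int) : expi (2 * pi * k%:~R : R) = 1.
Proof.
case: k => n; first exact: expi_2pi_nat.
by rewrite NegzE intrN mulrN expiN expi_2pi_nat conjc1.
Qed.

Lemma integral01_derive_eq0 (f F : R -> R) : continuous f ->
  (forall x : R, is_derive x 1 F (f x)) -> F 0 = F 1 ->
  \int[lebesgue_measure]_(x in `[0, 1]) f x = 0.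
Proof.
move=> cf dF F01; rewrite /Rintegral (@continuous_FTC2 _ f F)//=.
- by rewrite F01 subrr.
- exact: continuous_subspaceT.
- have cF : continuous F.
    by move=> x; apply: differentiable_continuous; apply/derivable1_diffP; apply: ex_derive.
  split; first by move=> x _; exact: ex_derive.
  + by apply: cvg_at_right_filter; exact: cF.
  + by apply: cvg_at_left_filter; exact: cF.
- by move=> x _; rewrite derive1E derive_val.
Qed.

Lemma continuous_cosZ (c : R) : continuous (fun x : R => cos (c * x)).
Proof.
move=> x; apply: (@continuous_comp _ _ _ (fun x => c * x) cos).
  exact: mulrl_continuous.
exact: continuous_cos.
Qed.

Lemma continuous_sinZ (c : R) : continuous (fun x : R => sin (c * x)).
Proof.
move=> x; apply: (@continuous_comp _ _ _ (fun x => c * x) sin).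
  exact: mulrl_continuous.
exact: continuous_sin.
Qed.

Lemma expect_uniform_cos (k : int) :
  \int[U]_x cos (2 * pi * k%:~R * x) = (k == 0)%:R.
Proof.
have [->|k0] := eqVneq k 0.
  under eq_Rintegral do rewrite mulr0 mul0r cos0.
  by rewrite expect_cst.
set c := 2 * pi * k%:~R.
have c0 : c != 0 by rewrite !mulf_neq0// ?intr_eq0// gt_eqF// pi_gt0.
rewrite expect_uniform; last first.
  apply: bmeas_cos; exact: measurable_funM.
rewrite /=; apply: (@integral01_derive_eq0 _ (fun x => c^-1 * sin (c * x))).
- exact: continuous_cosZ.
- move=> x; apply: is_derive_eq.
  by rewrite /GRing.scale/=; field.
- by have [_ s1] := expi_2pi_int k; rewrite mulr0 mulr1 sin0 s1.
Qed.

Lemma expect_uniform_sin (k : int) :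
  \int[U]_x sin (2 * pi * k%:~R * x) = 0.
Proof.
have [->|k0] := eqVneq k 0.
  under eq_Rintegral do rewrite mulr0 mul0r sin0.
  by rewrite expect_cst.
set c := 2 * pi * k%:~R.
have c0 : c != 0 by rewrite !mulf_neq0// ?intr_eq0// gt_eqF// pi_gt0.
rewrite expect_uniform; last first.
  apply: bmeas_sin; exact: measurable_funM.
rewrite /=; apply: (@integral01_derive_eq0 _ (fun x => - c^-1 * cos (c * x))).
- exact: continuous_sinZ.
- move=> x; apply: is_derive_eq.
  by rewrite /GRing.scale/=; field.
- by have [s1 _] := expi_2pi_int k; rewrite mulr0 mulr1 cos0 s1.
Qed.

Lemma expect_torusS d (h : d.+1.-tuple R -> R) : bmeas h ->
  \int[torus_measure R d.+1]_t h t =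
    \int[(U \x torus_measure R d)%E]_z h (tuple_cons z).
Proof.
move=> hh.
have hp : bmeas (fun z : measurableTypeR R * d.-tuple R => h (tuple_cons z)).
  case: hh => mh [M hM]; split; last by exists M.
  exact: (measurableT_comp mh (@measurable_tuple_cons R d)).
rewrite /Rintegral /= integral_distribution//.
  by apply/measurable_EFinP; case: hh.
exact: (bmeas_integrable (U \x torus_measure R d)%E hp).
Qed.

Lemma bmeas_prod d (f : measurableTypeR R -> R) (g : d.-tuple R -> R) :
  bmeas f -> bmeas g ->
  bmeas (fun z : measurableTypeR R * d.-tuple R => f z.1 * g z.2).
Proof.
move=> [mf [M hM]] [mg [N hN]]; apply: bmeasM; split.
- exact: (measurableT_comp mf measurable_fst).
- by exists M.
- exact: (measurableT_comp mg measurable_snd).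
- by exists N.
Qed.

Lemma expect_prod d (f : measurableTypeR R -> R) (g : d.-tuple R -> R) :
  bmeas f -> bmeas g ->
  \int[(U \x torus_measure R d)%E]_z (f z.1 * g z.2) =
    \int[U]_x f x * \int[torus_measure R d]_t g t.
Proof.
move=> hf hg.
have ip := bmeas_integrable (U \x torus_measure R d)%E (bmeas_prod hf hg).
have ig := bmeas_integrable (torus_measure R d) hg.
have igf : (\int[torus_measure R d]_t (g t)%:E)%E \is a fin_num.
  exact: integrable_fin_num.
have iff := bmeas_integrable U hf.
rewrite /Rintegral /= -(integral12_prod_meas1 ip).
transitivity (fine (\int[U]_x ((f x)%:E * \int[torus_measure R d]_t (g t)%:E))%E).
  congr fine; apply: eq_integral => x _.
  by rewrite -integralZl//; apply: eq_integral => y _ /=; rewrite EFinM.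
rewrite -[in LHS](fineK igf) integralZr//.
by rewrite fineM//; exact: (integrable_fin_num _ iff).
Qed.

(** A character of the (d+1)-torus is the product of a character of the circle
    and one of the d-torus, so Fubini reduces to the circle, where the primitive
    of a nontrivial character takes the same value at 0 and 1. *)
Lemma cexpectation_character d (p : 'cV[int]_d) :
  cexpectation (@character R d p) = (p == 0)%:R.
Proof.
elim: d p => [|d ih] p.
  have -> : p = 0 by apply/matrixP => -[].
  rewrite eqxx -[RHS](@cexpectation_cst R 0 1); congr cexpectation.
  by apply/funext => t; rewrite character0.
pose q : 'cV[int]_d := \col_i p (lift ord0 i) ord0.
have pE : (p == 0) = (p ord0 ord0 == 0) && (q == 0).
  apply/eqP/andP => [pz|[/eqP p0 /eqP q0]].
    split; apply/eqP; first by rewrite pz mxE.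
    by apply/matrixP => i j; rewrite !mxE pz mxE.
  apply/matrixP => i j; rewrite ord1 [RHS]mxE.
  case: (unliftP ord0 i) => [k ->|->//].
  by have /matrixP/(_ k ord0) := q0; rewrite !mxE.
have charS z : character p (tuple_cons z) =
    expi (2 * pi * (p ord0 ord0)%:~R * z.1) * character q z.2.
  case: z => u s; rewrite /character -expiD /dotZ big_ord_recl/= mulrDr mulrA tnth0.
  congr (expi (_ + _ * _)); apply: eq_bigr => i _.
  by rewrite mxE tnthS.
have mlin : measurable_fun setT
    (fun u : measurableTypeR R => 2 * pi * (p ord0 ord0)%:~R * u : R).
  exact: measurable_funM.
have [mR mI] := cbmeas_character p.
have [qR qI] := cbmeas_character q.
have hc := bmeas_cos mlin; have hs := bmeas_sin mlin.
have := ih q => /eqP; rewrite eq_complex/= => /andP[/eqP eR /eqP eI].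
apply: complex_eq.
- transitivity (\int[torus_measure R d.+1]_t complex.Re (character p t)) => [//|].
  rewrite expect_torusS//; under eq_Rintegral => z _ do rewrite charS ReM.
  rewrite expectB ?(expect_prod hc qR) ?(expect_prod hs qI).
  + rewrite expect_uniform_cos expect_uniform_sin mul0r subr0 eR pE.
    by case: (_ == 0); case: (_ == 0); rewrite /= ?mul1r ?mul0r.
  + exact: (bmeas_prod hc qR).
  + exact: (bmeas_prod hs qI).
- transitivity (\int[torus_measure R d.+1]_t complex.Im (character p t)) => [//|].
  rewrite expect_torusS//; under eq_Rintegral => z _ do rewrite charS ImM.
  rewrite expectD ?(expect_prod hc qI) ?(expect_prod hs qR).
  + rewrite expect_uniform_cos expect_uniform_sin mul0r addr0 eI pE.
    by case: (_ == 0); case: (_ == 0); rewrite /= ?mul1r ?mul0r ?mulr0.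
  + exact: (bmeas_prod hc qI).
  + exact: (bmeas_prod hs qR).
Qed.


End characters.

(** * Trigonometric polynomials with dissociated frequency sets *)

Section spectra.
Variables (R : realType) (d : nat).
Local Notation V := 'cV[int]_d.
Local Notation mu := (torus_measure R d).
Implicit Types (M N : set V) (F G : d.-tuple R -> R[i]).

(** F is a trigonometric polynomial with frequencies in M. The expansion is a
    list of pairs (coefficient, frequency), with repetitions allowed, so that
    sums and products of expansions are plain list operations. *)
Definition freqs_in M F := exists s : seq (R[i] * V),
  (forall z, z \in s -> M z.2) /\
  forall t, F t = \sum_(z <- s) z.1 * character z.2 t.

Definition sumset M N : set V := [set p + q | p in M & q in N].

Lemma freqs_in_sub M N F : M `<=` N -> freqs_in M F -> freqs_in N F.
Proof. by move=> MN [s [sM sE]]; exists s; split => // z /sM/MN. Qed.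

Lemma freqs_in_eq M F G : F =1 G -> freqs_in M F -> freqs_in M G.
Proof. by move=> FG; have <- : F = G by exact/funext. Qed.

Lemma freqs_in_character M p : M p -> freqs_in M (character p).
Proof.
move=> Mp; exists [:: (1, p)]; split => [z|t].
  by rewrite inE => /eqP ->.
by rewrite big_seq1 mul1r.
Qed.

Lemma freqs_in0 M : freqs_in M (fun=> 0).
Proof. by exists [::]; split => [//|t]; rewrite big_nil. Qed.

Lemma freqs_inD M F G : freqs_in M F -> freqs_in M G -> freqs_in M (fun t => F t + G t).
Proof.
move=> [s [sM sE]] [r [rM rE]]; exists (s ++ r); split => [z|t].
  by rewrite mem_cat => /orP[/sM|/rM].
by rewrite big_cat sE rE.
Qed.

Lemma freqs_inM M N F G : freqs_in M F -> freqs_in N G ->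
  freqs_in (sumset M N) (fun t => F t * G t).
Proof.
move=> [s [sM sE]] [r [rM rE]].
exists [seq (z.1 * w.1, z.2 + w.2) | z <- s, w <- r]; split => [z|t].
  by move=> /allpairsP[[z1 z2] /= [/sM h1 /rM h2 ->]]/=; exists z1.2 => //; exists z2.2.
rewrite big_allpairs_dep/= sE rE big_distrl/=; apply: eq_bigr => z _.
rewrite big_distrr/=; apply: eq_bigr => w _.
by rewrite characterD mulrACA.
Qed.

Lemma freqs_inZ M a F : freqs_in M F -> freqs_in M (fun t => a * F t).
Proof.
move=> [s [sM sE]]; exists [seq (a * z.1, z.2) | z <- s]; split => [z|t].
  by move=> /mapP[w /sM h ->].
by rewrite big_map sE big_distrr/=; apply: eq_bigr => z _; rewrite mulrA.
Qed.

Lemma freqs_in_cst M a : M 0 -> freqs_in M (fun=> a).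
Proof.
move=> M0; apply: (@freqs_in_eq _ (fun t => a * character 0 t)).
  by move=> t; rewrite character0 mulr1.
by apply: freqs_inZ; exact: freqs_in_character.
Qed.

Lemma freqs_in_sum M (I : eqType) (r : seq I) (F : I -> d.-tuple R -> R[i]) :
  (forall i, i \in r -> freqs_in M (F i)) -> freqs_in M (fun t => \sum_(i <- r) F i t).
Proof.
elim: r => [|i r ih] hF.
  by under eq_fun do rewrite big_nil; exact: freqs_in0.
under eq_fun do rewrite big_cons.
apply: freqs_inD; first by apply: hF; rewrite mem_head.
by apply: ih => j jr; apply: hF; rewrite inE jr orbT.
Qed.

Lemma freqs_in_cbmeas M F : freqs_in M F -> cbmeas F.
Proof.
move=> [s [_ sE]]; rewrite (_ : F = fun t => \sum_(z <- s) z.1 * character z.2 t).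
  apply: cbmeas_sum => z; apply: cbmeasM; first exact: cbmeas_cst.
  exact: cbmeas_character.
exact/funext.
Qed.

Lemma cexpectation_trig (s : seq (R[i] * V)) :
  cexpectation (fun t => \sum_(z <- s) z.1 * character z.2 t) =
  \sum_(z <- s) z.1 * (z.2 == 0)%:R.
Proof.
rewrite cexpectation_sum => [|z].
  apply: eq_bigr => z _.
  by rewrite cexpectationZ ?cexpectation_character//; exact: cbmeas_character.
apply: cbmeasM; first exact: cbmeas_cst.
exact: cbmeas_character.
Qed.

(** Expand both sides into characters: under the hypothesis a frequency p + q
    of the product vanishes exactly when p and q both vanish. *)
Lemma cexpectation_freqs_inM M N F G : freqs_in N G -> freqs_in M F ->
  (forall p q, N p -> M q -> q != 0 -> p + q != 0) ->
  cexpectation (fun t => G t * F t) = cexpectation G * cexpectation F.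
Proof.
move=> [s [sN sE]] [r [rM rE]] NM.
rewrite (_ : G = fun t => \sum_(z <- s) z.1 * character z.2 t); last exact/funext.
rewrite (_ : F = fun t => \sum_(z <- r) z.1 * character z.2 t); last exact/funext.
rewrite (_ : (fun t => _) = fun t =>
    \sum_(z <- [seq (z.1 * w.1, z.2 + w.2) | z <- s, w <- r]) z.1 * character z.2 t).
  rewrite !cexpectation_trig big_allpairs_dep/= big_distrl/= !big_seq.
  apply: eq_bigr => z zs; rewrite big_distrr/= !big_seq.
  apply: eq_bigr => w wr; rewrite mulrACA; congr (_ * _).
  have [w0|w0] := eqVneq w.2 0; first by rewrite w0 addr0 mulr1.
  by rewrite (negbTE (NM _ _ (sN _ zs) (rM _ wr) w0)) mulr0.
apply/funext => t; rewrite big_allpairs_dep/= big_distrl/=; apply: eq_bigr => z _.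
rewrite big_distrr/=; apply: eq_bigr => w _.
by rewrite characterD mulrACA.
Qed.

Fixpoint psums (M : nat -> set V) (K : nat) : set V :=
  if K is K'.+1 then sumset (psums M K') (M K') else [set 0].

(** The frequency-side substitute for independence: a nonzero frequency of the
    k-th set is never cancelled by frequencies from the earlier sets. Functions
    with frequencies in these sets are then multiplicative in mean. *)
Definition lacunary (u : nat) (M : nat -> set V) :=
  (forall k, (k < u)%N -> M k 0) /\
  (forall k p q, (k < u)%N -> psums M k p -> M k q -> q != 0 -> p + q != 0).

Section lacunary_theory.
Variables (u : nat) (M : nat -> set V).
Hypothesis lacM : lacunary u M.

Lemma freqs_in_prod_psums (F : nat -> d.-tuple R -> R[i]) K :
  (forall k, (k < K)%N -> freqs_in (M k) (F k)) ->
  freqs_in (psums M K) (fun t => \prod_(k < K) F k t).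
Proof.
elim: K => [|K ih] hF.
  by under eq_fun do rewrite big_ord0; exact: freqs_in_cst.
under eq_fun do rewrite big_ord_recr/=.
by apply: freqs_inM; [apply: ih => k kK; apply: hF; exact: ltnW|exact: hF].
Qed.

Lemma psums0 K : (K <= u)%N -> psums M K 0.
Proof.
elim: K => [//|K ih] Ku /=; exists 0; first exact/ih/ltnW.
by exists 0; rewrite ?addr0//; exact: lacM.1.
Qed.

Lemma freqs_in_sum_psums (F : nat -> d.-tuple R -> R[i]) K : (K <= u)%N ->
  (forall k, (k < K)%N -> freqs_in (M k) (F k)) ->
  freqs_in (psums M K) (fun t => \sum_(k < K) F k t).
Proof.
elim: K => [|K ih] Ku hF.
  by under eq_fun do rewrite big_ord0; exact: freqs_in_cst.
under eq_fun do rewrite big_ord_recr/=.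
apply: freqs_inD.
  apply: (@freqs_in_sub (psums M K)).
    by move=> p hp; exists p => //; exists 0; rewrite ?addr0//; exact: lacM.1.
  by apply: ih => [|k kK]; [exact: ltnW|apply: hF; exact: ltnW].
apply: (@freqs_in_sub (M K)); last exact: hF.
by move=> q hq; exists 0; [exact/psums0/ltnW|exists q; rewrite ?add0r].
Qed.

(** Peel off the last factor with [cexpectation_freqs_inM]. *)
Lemma cexpectation_lacunary_prod (F : nat -> d.-tuple R -> R[i]) :
  (forall k, (k < u)%N -> freqs_in (M k) (F k)) ->
  cexpectation (fun t => \prod_(k < u) F k t) = \prod_(k < u) cexpectation (F k).
Proof.
move=> hF; suff H K : (K <= u)%N ->
    cexpectation (fun t => \prod_(k < K) F k t) = \prod_(k < K) cexpectation (F k).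
  exact: H.
elim: K => [|K ih] Ku.
  under [fun t => _]eq_fun do rewrite big_ord0.
  by rewrite cexpectation_cst big_ord0.
under [fun t => _]eq_fun do rewrite big_ord_recr/=.
rewrite big_ord_recr/= -ih 1?ltnW//.
apply: (@cexpectation_freqs_inM (M K) (psums M K)).
- by apply: freqs_in_prod_psums => k kK; apply: hF; exact: ltn_trans Ku.
- exact: hF.
- by move=> p q; exact: lacM.2.
Qed.

Definition rfreqs_in N (f : d.-tuple R -> R) := freqs_in N (fun t => (f t)%:C%C).

Lemma rfreqs_in_bmeas N f : rfreqs_in N f -> bmeas f.
Proof. by move=> /freqs_in_cbmeas[]. Qed.

Lemma rfreqs_inZ N (a : R) f : rfreqs_in N f -> rfreqs_in N (fun t => a * f t).
Proof.
by move=> hf; rewrite /rfreqs_in; under eq_fun do rewrite rmorphM/=; exact: freqs_inZ.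
Qed.

Lemma expect_lacunary_prod (f : nat -> d.-tuple R -> R) :
  (forall k, (k < u)%N -> rfreqs_in (M k) (f k)) ->
  \int[mu]_t (\prod_(k < u) f k t) = \prod_(k < u) \int[mu]_t f k t.
Proof.
move=> hf; apply: (@complexI R); rewrite rmorph_prod/=.
rewrite -cexpectation_real.
under [fun t => _]eq_fun do rewrite rmorph_prod/=.
rewrite (@cexpectation_lacunary_prod (fun k t => (f k t)%:C%C))//.
by apply: eq_bigr => k _; rewrite cexpectation_real.
Qed.

(** The same peeling shows that the last summand is orthogonal to the sum of the
    earlier ones. *)
Lemma expect_lacunary_sum_sqr (f : nat -> d.-tuple R -> R) :
  (forall k, (k < u)%N -> rfreqs_in (M k) (f k)) ->
  (forall k, (k < u)%N -> \int[mu]_t f k t = 0) ->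
  \int[mu]_t ((\sum_(k < u) f k t) ^+ 2) = \sum_(k < u) \int[mu]_t (f k t ^+ 2).
Proof.
move=> hf f0; suff H K : (K <= u)%N ->
    \int[mu]_t ((\sum_(k < K) f k t) ^+ 2) = \sum_(k < K) \int[mu]_t (f k t ^+ 2).
  exact: H.
elim: K => [|K ih] Ku.
  under eq_Rintegral do rewrite big_ord0 expr0n/=.
  by rewrite expect_cst big_ord0.
rewrite big_ord_recr/= -ih 1?ltnW//.
have hfK k : (k < K)%N -> rfreqs_in (M k) (f k).
  by move=> kK; apply: hf; exact: ltn_trans Ku.
have bS : rfreqs_in (psums M K) (fun t => \sum_(k < K) f k t).
  rewrite /rfreqs_in; under eq_fun do rewrite rmorph_sum/=.
  by apply: (@freqs_in_sum_psums (fun k t => (f k t)%:C%C)) => //; exact: ltnW.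
have bf := hf _ Ku.
have cross : \int[mu]_t ((\sum_(k < K) f k t) * f K t) = 0.
  apply: (@complexI R); rewrite -cexpectation_real.
  under [fun t => _]eq_fun do rewrite rmorphM/=.
  rewrite (@cexpectation_freqs_inM (M K) (psums M K))//.
    by rewrite [X in _ * X]cexpectation_real f0// mulr0.
  by move=> p q; exact: lacM.2.
have mS := rfreqs_in_bmeas bS; have mf := rfreqs_in_bmeas bf.
have mSf := bmeasM mS mf.
under [LHS]eq_Rintegral do rewrite big_ord_recr/= sqrrD -[_ *+ 2]mulr_natl.
rewrite expectD ?expectD ?expectZ ?cross//; try by [exact: bmeasX|exact: bmeasZ].
  by rewrite mulr0 addr0.
by apply: bmeasD; [exact: bmeasX|exact: bmeasZ].
Qed.

End lacunary_theory.

End spectra.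

(** * Orbit sums and their frequencies *)

(* The products [mxprod] are big operators over matrix multiplication. *)
HB.instance Definition _ (d : nat) := Monoid.isLaw.Build 'M[int]_d 1%:M
  (@mulmx int d d d) (@mulmxA _ _ _ _ _) (@mul1mx _ _ _) (@mulmx1 _ _ _).

Section orbit_frequencies.
Variables (R : realType) (d : nat).
Local Notation V := 'cV[int]_d.
Local Notation mu := (torus_measure R d).
Implicit Types (A : nat -> 'M[int]_d) (g : d.-tuple R -> R) (D : R).

Lemma mxprodS A l : mxprod A 1 l.+1 = mxprod A 1 l *m A l.+1.
Proof. by rewrite /mxprod big_nat_recr. Qed.

Lemma mxprod0 A : mxprod A 1 0 = 1%:M.
Proof. by rewrite /mxprod big_geq. Qed.

Lemma det_mxprod A l : (forall k, (1 <= k <= l)%N -> \det (A k) = 1) ->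
  \det (mxprod A 1 l) = 1.
Proof.
elim: l => [|l ih] hA; first by rewrite mxprod0 det1.
rewrite mxprodS det_mulmx ih ?mul1r ?hA ?leqnn//.
by move=> k /andP[k1 kl]; rewrite hA// k1 ltnW.
Qed.

(** Reducing a coordinate of the image modulo 1 changes the phase by an
    integral multiple of 2 pi. *)
Lemma character_torus_map (B : 'M[int]_d) (p : V) (t : d.-tuple R) :
  character p (torus_map B t) = character (B *m p) t.
Proof.
pose fl i := Num.floor (\sum_(j < d) (B^T i j)%:~R * tnth t j).
have -> : character (B *m p) t = expi (2 * pi * dotZ p (torus_map B t)) *
    expi (2 * pi * (\sum_(i < d) p i ord0 * fl i)%:~R).
  rewrite -expiD /character -mulrDr; congr (expi (_ * _)).
  rewrite /dotZ rmorph_sum/= -big_split/=.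
  under [RHS]eq_bigr => i _.
    rewrite tnth_mktuple /mod1 -/(fl i) rmorphM/= -mulrDr subrK mulr_sumr.
    over.
  rewrite exchange_big/=; apply: eq_bigr => i _.
  rewrite mxE rmorph_sum/= mulr_suml; apply: eq_bigr => j _.
  by rewrite mxE rmorphM/= mulrAC mulrC mulrA.
by rewrite expi_2pi_int mulr1.
Qed.

Lemma character_torus_orbit A (p : V) l (t : d.-tuple R) :
  character p (torus_orbit A l t) = character (mxprod A 1 l *m p) t.
Proof.
elim: l p => [|l ih] p; first by rewrite mxprod0 mul1mx.
by rewrite /= character_torus_map ih mxprodS mulmxA.
Qed.

Lemma freqs_in_torus_orbit A l (M : set V) (F : d.-tuple R -> R[i]) : freqs_in M F ->
  freqs_in [set mxprod A 1 l *m p | p in M] (fun t => F (torus_orbit A l t)).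
Proof.
move=> [s [sM sE]]; exists [seq (z.1, mxprod A 1 l *m z.2) | z <- s]; split.
  by move=> z /mapP[w /sM Mw ->]/=; exists w.2.
by move=> t; rewrite sE big_map; apply: eq_bigr => z _; rewrite character_torus_orbit.
Qed.

(** A matrix of determinant 1 fixes the zero frequency and moves no other
    frequency there, so the constant term is unchanged. *)
Lemma cexpectation_torus_orbit A l (M : set V) (F : d.-tuple R -> R[i]) :
  (forall k, (1 <= k <= l)%N -> \det (A k) = 1) -> freqs_in M F ->
  cexpectation (fun t => F (torus_orbit A l t)) = cexpectation F.
Proof.
move=> hA [s [_ sE]].
rewrite (_ : F = fun t => \sum_(z <- s) z.1 * character z.2 t); last exact/funext.
rewrite (_ : (fun t => _) = fun t =>
    \sum_(z <- [seq (z.1, mxprod A 1 l *m z.2) | z <- s]) z.1 * character z.2 t).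
  rewrite !cexpectation_trig big_map; apply: eq_bigr => z _ /=; congr (_ * _%:R).
  have Au : mxprod A 1 l \in unitmx by rewrite unitmxE det_mxprod// unitr1.
  congr nat_of_bool; apply/eqP/eqP => [e|->]; last by rewrite mulmx0.
  by rewrite -(mulKmx Au z.2) e mulmx0.
by apply/funext => t; rewrite big_map; apply: eq_bigr => z _; rewrite character_torus_orbit.
Qed.

Definition low_freqs D : set V := [set p | (max_norm p)%:R <= D].

(** The coefficients of a given expansion may repeat a frequency p; the
    Fourier coefficient is then the multiplicity times the coefficient. *)
Lemma rfreqs_in_real_trig_poly g D : real_trig_poly g ->
  (forall p : V, D < (max_norm p)%:R -> fourier_coef g p = 0) ->
  rfreqs_in (low_freqs D) g.
Proof.
move=> [s [c sE]] gD.
have cD p : p \in s -> D < (max_norm p)%:R -> c p = 0.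
  move=> ps /gD; rewrite /fourier_coef.
  rewrite (_ : (fun t => _) = fun t =>
      \sum_(z <- [seq (c q, q - p) | q <- s]) z.1 * character z.2 t); last first.
    apply/funext => t; rewrite sE -characterN big_distrl/= big_map.
    by apply: eq_bigr => q _; rewrite characterD mulrA.
  rewrite cexpectation_trig big_map/=.
  under eq_bigr do rewrite subr_eq0.
  rewrite (bigID (pred1 p))/= [X in _ + X]big1 => [|q /negbTE ->]; last by rewrite mulr0.
  rewrite (eq_bigr (fun=> c p)) => [|q /eqP ->]; last by rewrite eqxx mulr1.
  rewrite big_const_seq iter_addr !addr0 => /eqP.
  rewrite mulrn_eq0 => /orP[|/eqP//].
  by rewrite -leqn0 leqNgt -has_count has_pred1 ps.
exists [seq (c p, p) | p <- s & (max_norm p)%:R <= D]; split.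
  by move=> z /mapP[p]; rewrite mem_filter => /andP[pD _] ->.
move=> t; rewrite sE big_map big_filter/= [RHS]big_mkcond/= !big_seq.
apply: eq_bigr => p ps; case: ifPn => //; rewrite -ltNge => /(cD _ ps) ->.
by rewrite mul0r.
Qed.

Definition orbit_freqs A D (a b : nat) : set V :=
  [set v | exists l p, [/\ (a <= l <= b)%N, low_freqs D p & v = mxprod A 1 l *m p]].

(** The frequencies of the square of a block sum; when
    0 <= D and a <= b, 0 is an orbit frequency, so that those of the block sum
    itself are among them. *)
Definition block_freqs A D (a b : nat) : set V :=
  sumset (orbit_freqs A D a b) (orbit_freqs A D a b).

Definition block_sum A g (a b : nat) (t : d.-tuple R) : R :=
  \sum_(a <= l < b.+1) g (torus_orbit A l t).

Lemma max_norm0 : max_norm (0 : V) = 0%N.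
Proof. by apply: big1 => i _; rewrite mxE. Qed.

Lemma orbit_freqs0 A D a b : 0 <= D -> (a <= b)%N -> orbit_freqs A D a b 0.
Proof.
move=> D0 ab; exists a, 0; split; [by rewrite leqnn|by rewrite /low_freqs/= max_norm0|].
by rewrite mulmx0.
Qed.

Lemma rfreqs_in_orbit_freqs A D g a b : rfreqs_in (low_freqs D) g ->
  rfreqs_in (orbit_freqs A D a b) (block_sum A g a b).
Proof.
move=> gD; rewrite /rfreqs_in /block_sum; under eq_fun do rewrite rmorph_sum/=.
apply: (@freqs_in_sum _ _ _ _ _ (fun l t => (g (torus_orbit A l t))%:C%C)) => l.
rewrite mem_index_iota => hl; apply: freqs_in_sub (freqs_in_torus_orbit A l gD) => v [p pD <-].
by exists l, p.
Qed.

Lemma rfreqs_in_block_sum A D g a b : 0 <= D -> (a <= b)%N -> rfreqs_in (low_freqs D) g ->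
  rfreqs_in (block_freqs A D a b) (block_sum A g a b).
Proof.
move=> D0 ab gD; apply: freqs_in_sub (rfreqs_in_orbit_freqs A a b gD) => v hv.
by exists v => //; exists 0; rewrite ?addr0//; exact: orbit_freqs0.
Qed.

Lemma rfreqs_in_block_sum_sqr A D g a b : rfreqs_in (low_freqs D) g ->
  rfreqs_in (block_freqs A D a b) (fun t => block_sum A g a b t ^+ 2).
Proof.
move=> gD; rewrite /rfreqs_in; under eq_fun do rewrite expr2 rmorphM/=.
by apply: freqs_inM; exact: rfreqs_in_orbit_freqs.
Qed.

Lemma expect_block_sum A D g a b :
  (forall k, (1 <= k <= b)%N -> \det (A k) = 1) ->
  rfreqs_in (low_freqs D) g -> \int[mu]_t g t = 0 ->
  \int[mu]_t block_sum A g a b t = 0.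
Proof.
move=> hA gD g0; apply: (@complexI R); rewrite -cexpectation_real.
rewrite /block_sum; under [fun t => _]eq_fun do rewrite rmorph_sum/=.
have bX l : cbmeas (fun t => (g (torus_orbit A l t))%:C%C).
  exact: freqs_in_cbmeas (freqs_in_torus_orbit A l gD).
rewrite (@cexpectation_sum _ _ _ _ (fun l t => (g (torus_orbit A l t))%:C%C))//.
rewrite big_seq big1// => l; rewrite mem_index_iota => /andP[_ lb].
rewrite (cexpectation_torus_orbit _ gD) ?cexpectation_real ?g0//.
by move=> k /andP[k1 kl]; rewrite hA// k1 (leq_trans kl).
Qed.

Section lacunary_blocks.
Variables (n q u : nat) (A : nat -> 'M[int]_d) (D Delta : R) (a b : nat -> nat).
Hypothesis AS : propS n A D Delta.
Hypothesis D0 : 0 <= D.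
Hypothesis Deltaq : Delta <= q.+1%:R.
Hypothesis ab : forall k, (k < u)%N -> (1 <= a k <= b k)%N /\ (b k <= n)%N.
Hypothesis gap : forall k, (k.+1 < u)%N -> (b k + q.+1 <= a k.+1)%N.

Let M k := block_freqs A D (a k) (b k).

Let freq (l l' : nat -> nat) (p p' : nat -> V) k :=
  mxprod A 1 (l' k) *m p' k + mxprod A 1 (l k) *m p k.

Let good (l l' : nat -> nat) (p p' : nat -> V) k :=
  [/\ (a k <= l k)%N, (l k <= l' k)%N, (l' k <= b k)%N, low_freqs D (p k) &
      low_freqs D (p' k)].

Let block_freqsE k v : M k v -> exists l l' p p',
  good (fun=> l) (fun=> l') (fun=> p) (fun=> p') k /\
  v = freq (fun=> l) (fun=> l') (fun=> p) (fun=> p') k.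
Proof.
move=> [_ [l [p [/andP[al lb] pD ->]]] [_ [l' [p' [/andP[al' lb'] pD' ->]]] <-]].
have [ll'|/ltnW ll'] := leqP l l'.
  by exists l, l', p, p'; split; [split|rewrite /freq addrC].
by exists l', l, p', p; split; [split|].
Qed.

(* Extends a choice of indices and frequencies to one more block. *)
Let up T K (f : nat -> T) x k := if k == K then x else f k.

Let good_up K l l' p p' m m' r r' :
  (forall k, (k < K)%N -> good l l' p p' k) ->
  good (fun=> m) (fun=> m') (fun=> r) (fun=> r') K ->
  forall k, (k < K.+1)%N -> good (up K l m) (up K l' m') (up K p r) (up K p' r') k.
Proof.
move=> h hK k; rewrite ltnS leq_eqVlt => /predU1P[->|kK].
  by rewrite /good /up eqxx.
by rewrite /good /up ltn_eqF//; exact: h.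
Qed.

Let psums_freqs K p0 : psums M K p0 -> exists l l' p p',
  (forall k, (k < K)%N -> good l l' p p' k) /\ p0 = \sum_(k < K) freq l l' p p' k.
Proof.
elim: K p0 => [? ->|K ih ? [w /ih[l [l' [p [p' [h ->]]]]]]].
  by exists (fun=> 0%N), (fun=> 0%N), (fun=> 0), (fun=> 0); rewrite big_ord0.
move=> [v /block_freqsE[m [m' [r [r' [hK ->]]]]] <-].
exists (up K l m), (up K l' m'), (up K p r), (up K p' r').
split; first exact: good_up.
rewrite big_ord_recr/=; congr (_ + _); last by rewrite /freq /up eqxx.
by apply: eq_bigr => k _; rewrite /freq /up ltn_eqF.
Qed.

(** A frequency of a block is A_1^l p + A_1^l' p' with l and l' in the block, and
    these can be ordered as l <= l'. One such choice per block is exactly the data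
    to which the property S(D, Delta) applies. *)
Lemma lacunary_blocks : lacunary u M.
Proof.
split=> [k ku|K p0 v Ku].
  have [/andP[_ akb] _] := ab ku.
  by exists 0; [|exists 0; rewrite ?addr0//]; exact: orbit_freqs0.
move=> /psums_freqs[l [l' [p [p' [h ->]]]]].
move=> /block_freqsE[m [m' [r [r' [hK ->]]]]] v0.
have hup := good_up h hK.
pose sh T (f : nat -> T) j := f j.-1.
have js j : (1 <= j <= K.+1)%N -> (j.-1 < K.+1)%N by case: j.
have := @AS K.+1 (sh _ (up K l m)) (sh _ (up K l' m')) (sh _ (up K p r)) (sh _ (up K p' r')).
have -> : \sum_(1 <= j < K.+2) (mxprod A 1 (sh _ (up K l' m') j) *m sh _ (up K p' r') j +
      mxprod A 1 (sh _ (up K l m) j) *m sh _ (up K p r) j) =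
    \sum_(k < K) freq l l' p p' k + freq (fun=> m) (fun=> m') (fun=> r) (fun=> r') K.
  rewrite big_add1/= big_mkord big_ord_recr/= /sh/=; congr (_ + _); last by rewrite /freq /up eqxx.
  by apply: eq_bigr => k _; rewrite /freq /up ltn_eqF.
apply => //.
- move=> j /js jK; have [aj lj bj _ _] := hup _ jK.
  have [/andP[a1 _] bn] := ab (leq_trans jK Ku).
  by rewrite /sh (leq_trans a1 aj) lj (leq_trans bj bn).
- case=> // j /andP[_ jK]; have [_ _ bj _ _] := hup j (ltnW jK).
  have [aj _ _ _ _] := hup j.+1 jK.
  have := gap (leq_ltn_trans (jK : (j.+1 <= K)%N) Ku); rewrite /sh/= => g.
  by apply: leq_trans bj _; apply: leq_trans aj; apply: leq_trans g; rewrite leq_addr.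
- case=> // j /andP[_ jK]; have [_ _ bj _ _] := hup j (ltnW jK).
  have [aj _ _ _ _] := hup j.+1 jK.
  have g := gap (leq_ltn_trans (jK : (j.+1 <= K)%N) Ku).
  apply: le_trans (_ : (up K l' m' j)%:R + q.+1%:R <= _); first by rewrite lerD2l.
  rewrite -natrD ler_nat; apply: leq_trans aj; apply: leq_trans g.
  by rewrite leq_add2r.
- by rewrite /sh/= /up eqxx.
- by move=> j /js jK; have [_ _ _ pj pj'] := hup _ jK.
Qed.


End lacunary_blocks.

End orbit_frequencies.

(** * Elementary inequalities for the exponential *)

Section exponential_inequalities.
Variable R : realType.
Local Notation normc := (@ComplexField.Normc.normc R).

Lemma lipschitz_derive (f df : R -> R) (M a b : R) :
  (forall x : R, is_derive x 1 f (df x)) -> (forall x, `|df x| <= M) ->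
  `|f a - f b| <= M * `|a - b|.
Proof.
move=> fdf dfM; wlog ba : a b / b <= a.
  move=> H; have [/H//|/ltW/H] := leP b a.
  by rewrite distrC [`|b - a|]distrC.
have [|c _ ->] := @MVT_segment R f df b a ba (fun x _ => fdf x).
  apply: derivable_within_continuous => x _; exact: ex_derive.
by rewrite normrM ler_wpM2r.
Qed.

Lemma sin_lipschitz (a b : R) : `|sin a - sin b| <= `|a - b|.
Proof.
rewrite -[leRHS]mul1r.
by apply: (@lipschitz_derive (@sin R) (@cos R) 1 a b (@is_derive_sin R)) => x; exact: cos_max.
Qed.

Lemma cos_lipschitz (a b : R) : `|cos a - cos b| <= `|a - b|.
Proof.
rewrite -[leRHS]mul1r.
apply: (@lipschitz_derive (@cos R) (fun x => - sin x) 1 a b (@is_derive_cos R)) => x.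
by rewrite normrN; exact: sin_max.
Qed.

Lemma normr_sin_le (y : R) : `|sin y| <= `|y|.
Proof. by have := sin_lipschitz y 0; rewrite sin0 !subr0. Qed.

Lemma normc_expi_sub (a b : R) :
  normc (expi a - expi b) <= 2 * `|a - b|.
Proof.
rewrite (le_trans (normc_le_ReIm _))//= mulr2n mulrDl mul1r lerD//.
  exact: cos_lipschitz.
exact: sin_lipschitz.
Qed.

Lemma cos_half (y : R) : cos y = 1 - 2 * sin (y / 2) ^+ 2.
Proof.
have -> : cos y = cos ((y / 2) *+ 2) by congr cos; rewrite -mulr_natr divfK.
rewrite cos_mulr2n -[_ *+ 2]mulr_natl cos2sin2; ring.
Qed.

Lemma cos_sub1_le (y : R) : `|1 - cos y| <= y ^+ 2 / 2.
Proof.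
rewrite cos_half (_ : 1 - (1 - _) = 2 * sin (y / 2) ^+ 2); last by ring.
rewrite ger0_norm; last by rewrite mulr_ge0 ?sqr_ge0.
have : sin (y / 2) ^+ 2 <= (y / 2) ^+ 2.
  rewrite -(real_normK (num_real (sin _))) -(real_normK (num_real (y / 2))).
  by rewrite ler_sqr ?nnegrE// normr_sin_le.
lra.
Qed.

(** Mean value theorem, with the derivative bounded by [cos_sub1_le]. *)
Lemma sin_sub_le (y : R) : `|y - sin y| <= `|y| ^+ 3 / 2.
Proof.
wlog y0 : y / 0 <= y.
  move=> H; have [/H//|/ltW yl] := leP 0 y.
  by have := H (- y); rewrite oppr_ge0 sinN -opprD !normrN; exact.
pose f := (fun x : R => x - sin x); pose df := (fun x : R => 1 - cos x).
have fdf (x : R) : is_derive x 1 f (df x) by exact: is_deriveB.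
have [|c cy] := @MVT_segment R f df 0 y y0 (fun x _ => fdf x).
  by apply: derivable_within_continuous => x _; exact: ex_derive.
rewrite /f sin0 !subr0 => ->; rewrite normrM.
have [c0 cyy] : 0 <= c /\ c <= y by move: cy; rewrite in_itv/= => /andP.
have := cos_sub1_le c; rewrite -/(df c) => h.
have -> : `|y| ^+ 3 / 2 = (`|y| ^+ 2 / 2) * `|y| by rewrite exprSr; field.
rewrite ler_wpM2r// (le_trans h)// ler_pM2r// !ger0_norm// ler_sqr ?nnegrE//.
Qed.

(** With h = y / 2 the error is 2 (h^2 - sin^2 h) = 2 (h - sin h)(h + sin h). *)
Lemma cos_taylor2 (y : R) : `|cos y - (1 - y ^+ 2 / 2)| <= y ^+ 4 / 8.
Proof.
rewrite cos_half; set h := y / 2.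
have -> : y = 2 * h by rewrite /h; field.
have -> : 1 - 2 * sin h ^+ 2 - (1 - (2 * h) ^+ 2 / 2) =
  2 * ((h - sin h) * (h + sin h)) by field.
rewrite normrM ger0_norm// normrM.
have h1 := sin_sub_le h.
have h2 : `|h + sin h| <= 2 * `|h|.
  by rewrite (le_trans (ler_normD _ _))// mulr2n mulrDl mul1r lerD2l normr_sin_le.
have h3 := ler_pM (normr_ge0 _) (normr_ge0 _) h1 h2.
rewrite -[h in leRHS]/h.
have -> : (2 * h) ^+ 4 / 8 = 2 * (`|h| ^+ 3 / 2 * (2 * `|h|)).
  transitivity (2 * (h ^+ 2) ^+ 2); first by field.
  by rewrite -(real_normK (num_real h)); field.
by rewrite ler_pM2l.
Qed.

Lemma expRN_taylor1 (s : R) : 0 <= s -> `|expR (- s) - (1 - s)| <= s ^+ 2.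
Proof.
move=> s0; have h := expR_ge1Dx (- s); have h' := expR_ge1Dx s.
rewrite ger0_norm ?subr_ge0//.
have : expR (- s) <= (1 + s)^-1.
  by rewrite expRN lef_pV2 ?posrE ?expR_gt0//; lra.
move=> k; apply: (@le_trans _ _ ((1 + s)^-1 - (1 - s))); first by rewrite lerD2r.
have s1 : 0 < 1 + s by lra.
rewrite -subr_ge0 (_ : _ - _ = s ^+ 3 / (1 + s)); last by field; rewrite gt_eqF.
by rewrite divr_ge0 ?exprn_ge0// ltW.
Qed.

Lemma expRN_lipschitz (a b : R) : 0 <= a -> 0 <= b ->
  `|expR (- a) - expR (- b)| <= `|a - b|.
Proof.
wlog ab : a b / a <= b.
  move=> H a0 b0; have [ab|/ltW ba] := leP a b; first exact: H.
  by rewrite distrC [`|a - b|]distrC; exact: H.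
move=> a0 b0; rewrite [`|a - b|]distrC !ger0_norm ?subr_ge0 ?ler_expR ?lerN2//.
have -> : expR (- b) = expR (- a) * expR (- (b - a)) by rewrite -expRD; congr expR; ring.
have := expR_ge1Dx (- (b - a)).
have : expR (- a) <= 1 by rewrite -expR0 ler_expR oppr_le0.
have := expR_gt0 (- a); set u := expR (- a); set w := expR (- (b - a)) => u0 u1 h.
have ba : 0 <= b - a by lra.
have hw : w <= 1 by rewrite -expR0 ler_expR oppr_le0.
have : u * (1 - w) <= 1 * (b - a) by rewrite ler_pM ?(ltW u0)//; lra.
lra.
Qed.

(** The factor (1 + iy) e^(-y^2/2) replacing e^(iy): it agrees with it up to
    O(|y|^3) and its modulus is at most 1, so that products telescope without
    loss. *)
Definition gauss_factor (y : R) : R[i] := Complex 1 y * (expR (- (y ^+ 2 / 2)))%:C%C.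

Lemma normc_1Di (y : R) : normc (Complex 1 y) ^+ 2 = 1 + y ^+ 2.
Proof. by rewrite /= expr1n sqr_sqrtr// addr_ge0 ?sqr_ge0. Qed.

Lemma normc_1Di_le (y : R) : normc (Complex 1 y) <= expR (y ^+ 2 / 2).
Proof.
rewrite -ler_sqr ?nnegrE ?expR_ge0 ?normc_ge0// normc_1Di -expRM_natl.
by rewrite (_ : 2%:R * _ = y ^+ 2) ?expR_ge1Dx//; field.
Qed.

Lemma normc_gauss_factor (y : R) : normc (gauss_factor y) <= 1.
Proof.
rewrite /gauss_factor ComplexField.Normc.normcM normc_real ger0_norm ?expR_ge0//.
by rewrite expRN ler_pdivrMr ?expR_gt0// mul1r normc_1Di_le.
Qed.

(** For |y| <= 1 the Taylor errors of the real part are of order y^4; for larger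
    y the real parts differ by at most 2. *)
Lemma expi_gauss_factor (y : R) :
  normc (expi y - gauss_factor y) <= 3 * `|y| ^+ 3.
Proof.
set e := expR (- (y ^+ 2 / 2)).
have -> : expi y - gauss_factor y = Complex (cos y - e) (sin y - y * e).
  rewrite /gauss_factor -/e (_ : _ * _ = Complex e (y * e)) //.
  by apply: complex_eq; rewrite ?ReM ?ImM /=; ring.
rewrite (le_trans (normc_le_ReIm _))//=.
have y2 : 0 <= y ^+ 2 / 2 by rewrite divr_ge0 ?sqr_ge0.
have e0 : 0 < e by exact: expR_gt0.
have e1 : e <= 1 by rewrite -expR0 ler_expR oppr_le0.
have hc : `|cos y - e| <= 2 * `|y| ^+ 3.
  have [y1|/ltW y1] := leP `|y| 1.
    have h1 := cos_taylor2 y; have h2 := expRN_taylor1 y2.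
    have -> : cos y - e = (cos y - (1 - y ^+ 2 / 2)) - (e - (1 - y ^+ 2 / 2)) by ring.
    rewrite (le_trans (ler_normB _ _))// (le_trans (lerD h1 h2))//.
    have -> : y ^+ 4 / 8 + (y ^+ 2 / 2) ^+ 2 = 3 / 8 * (`|y| ^+ 3 * `|y|).
      transitivity (3 / 8 * (y ^+ 2) ^+ 2); first by field.
      by rewrite -(real_normK (num_real y)); field.
    have : 0 <= `|y| ^+ 3 by rewrite exprn_ge0.
    have : `|y| ^+ 3 * `|y| <= `|y| ^+ 3 * 1 by rewrite ler_wpM2l ?exprn_ge0.
    lra.
  have : 1 <= `|y| ^+ 3 by rewrite exprn_ege1.
  have := cos_max y; rewrite ler_norml => /andP[? ?] ?.
  by rewrite ler_norml; apply/andP; split; lra.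
have hs : `|sin y - y * e| <= `|y| ^+ 3.
  have h1 := sin_sub_le y.
  have -> : sin y - y * e = - (y - sin y) + y * (1 - e) by ring.
  rewrite (le_trans (ler_normD _ _))// normrN normrM.
  have : `|1 - e| <= `|y| ^+ 2 / 2.
    rewrite ger0_norm ?subr_ge0// real_normK ?num_real//.
    by have := expR_ge1Dx (- (y ^+ 2 / 2)); rewrite -/e; lra.
  move=> /(ler_wpM2l (normr_ge0 y)).
  have -> : `|y| * (`|y| ^+ 2 / 2) = `|y| ^+ 3 / 2 by rewrite !exprS; ring.
  lra.
lra.
Qed.

Lemma normc_prod_le1 (u : nat) (z : nat -> R[i]) :
  (forall k, normc (z k) <= 1) -> normc (\prod_(k < u) z k) <= 1.
Proof.
move=> z1; elim: u => [|u ih].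
  by rewrite big_ord0 ComplexField.Normc.normc1.
rewrite big_ord_recr/= ComplexField.Normc.normcM.
by rewrite mulr_ile1 ?normc_ge0.
Qed.

Lemma normc_prod_sub_le (u : nat) (z w : nat -> R[i]) :
  (forall k, normc (z k) <= 1) -> (forall k, normc (w k) <= 1) ->
  normc (\prod_(k < u) z k - \prod_(k < u) w k) <= \sum_(k < u) normc (z k - w k).
Proof.
move=> z1 w1; elim: u => [|u ih].
  by rewrite !big_ord0 subrr ComplexField.Normc.normc0.
rewrite !big_ord_recr/=.
set a := \prod_(k < u) z k; set b := \prod_(k < u) w k.
have -> : a * z u - b * w u = (a - b) * z u + b * (z u - w u) by ring.
rewrite (le_trans (le_normcD _ _))// !ComplexField.Normc.normcM lerD//.
  by rewrite (le_trans _ ih)// ler_piMr ?normc_ge0.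
by rewrite ler_piMl ?normc_ge0//; exact: normc_prod_le1.
Qed.

(** If V < v - 1 the bound r <= e^(V/2) gives r e^(-V/2) <= 1 <= |V - v|;
    otherwise |e^((v-V)/2) - 1| <= |v - V|. *)
Lemma gauss_replace (r V v : R) : 0 <= r -> r <= expR (V / 2) ->
  r * `|expR (- (V / 2)) - expR (- (v / 2))| <=
  `|V - v| + `|(V - v) * (r * expR (- (v / 2)))|.
Proof.
move=> r0 rV; have [Vv|Vv] := ltP V (v - 1).
  have d0 : 0 <= expR (- (V / 2)) - expR (- (v / 2)).
    by rewrite subr_ge0 ler_expR; lra.
  apply: (@le_trans _ _ 1).
    rewrite ger0_norm// (@le_trans _ _ (r * expR (- (V / 2))))//.
      by rewrite ler_wpM2l// lerBlDr lerDl expR_ge0.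
    by rewrite expRN ler_pdivrMr ?expR_gt0// mul1r.
  rewrite ler_wpDr// ltr0_norm; lra.
rewrite ler_wpDl//; set s := (v - V) / 2.
have -> : expR (- (V / 2)) - expR (- (v / 2)) = expR (- (v / 2)) * (expR s - 1).
  by rewrite mulrBr mulr1 -expRD; congr (expR _ - _); rewrite /s; field.
rewrite !normrM (ger0_norm r0) !(ger0_norm (expR_ge0 _)).
suff h : `|expR s - 1| <= `|V - v|.
  rewrite [leLHS]mulrA [leRHS]mulrC; apply: ler_wpM2l => //.
  by rewrite mulr_ge0 ?expR_ge0.
have -> : `|V - v| = 2 * `|s|.
  rewrite distrC (_ : v - V = 2 * s) ?normrM ?(ger0_norm ler0n)//.
    by rewrite ger0_norm.
  by rewrite /s; field.
have [s0|s0] := leP 0 s.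
  have e1 : 1 <= expR s by have := expR_ge1Dx s; lra.
  rewrite !ger0_norm ?subr_ge0//.
  have s1 : s <= 1 / 2 by rewrite /s; lra.
  have h := expR_ge1Dx (- s).
  have := expR_gt0 s; have : expR s * expR (- s) = 1 by rewrite expRN divff// gt_eqF ?expR_gt0.
  set w := expR s; set w' := expR (- s) in h * => ww w0.
  have : w * (1 - s) <= 1 by rewrite -ww ler_pM2l//; lra.
  nra.
have h := expR_ge1Dx s.
have : expR s <= 1 by rewrite -expR0 ler_expR; exact: ltW.
rewrite (ltr0_norm s0) => e1.
rewrite ler0_norm; lra.
Qed.

End exponential_inequalities.

(** * Gaussian approximation for lacunary sums *)

Section lacunary_characteristic_function.
Variables (R : realType) (d : nat).
Local Notation mu := (torus_measure R d).
Local Notation normc := (@ComplexField.Normc.normc R).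

Lemma bmeas_normc (F : d.-tuple R -> R[i]) : cbmeas F -> bmeas (fun t => normc (F t)).
Proof.
move=> [[mR [M hM]] [mI [N hN]]].
rewrite (_ : (fun t => _) =
    fun t => Num.sqrt (complex.Re (F t) ^+ 2 + complex.Im (F t) ^+ 2)); last first.
  by apply/funext => t; case: (F t).
split.
  apply: (measurableT_comp (f := @Num.sqrt R)).
    by apply: continuous_measurable_fun => x; exact: sqrt_continuous.
  by apply: measurable_funD; exact: measurable_funX.
exists (M + N) => t; rewrite ger0_norm// -[X in Num.sqrt X](_ : normc (F t) ^+ 2 = _).
  rewrite sqrtr_sqr ger0_norm ?normc_ge0// (le_trans (normc_le_ReIm _))// lerD//.
by case: (F t) => a b /=; rewrite sqr_sqrtr// addr_ge0 ?sqr_ge0.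
Qed.

Lemma expi_sum (u : nat) (a : nat -> R) :
  expi (\sum_(k < u) a k) = \prod_(k < u) expi (a k).
Proof. by elim: u => [|u ih]; rewrite ?big_ord0 ?expi0// !big_ord_recr/= expiD ih. Qed.

Variables (u : nat) (M : nat -> set 'cV[int]_d) (y : nat -> d.-tuple R -> R).
Hypothesis lacM : lacunary u M.
Hypothesis yM : forall k, (k < u)%N -> rfreqs_in (M k) (y k).
Hypothesis y2M : forall k, (k < u)%N -> rfreqs_in (M k) (fun t => y k t ^+ 2).
Hypothesis y0 : forall k, (k < u)%N -> \int[mu]_t y k t = 0.

Let V t := \sum_(k < u) y k t ^+ 2.
Let v := \sum_(k < u) \int[mu]_t (y k t ^+ 2).
Let Q t : R[i] := \prod_(k < u) Complex 1 (y k t).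

Let ymeas (k : 'I_u) : bmeas (y k). Proof. exact: rfreqs_in_bmeas (yM (ltn_ord k)). Qed.

Let cmeas_1Diy (k : 'I_u) : cbmeas (fun t => Complex 1 (y k t)).
Proof. by split; [exact: bmeas_cst|exact: ymeas]. Qed.

Let Vmeas : bmeas V.
Proof. by apply: bmeas_sum => k _; apply: bmeasX; exact: ymeas. Qed.

Let Qmeas : cbmeas Q.
Proof. exact: (@cbmeas_prod _ _ _ _ (fun (k : 'I_u) t => Complex 1 (y k t))). Qed.

(** The centred squares y_k^2 - E y_k^2 are orthogonal, so the variance of V is
    the sum of their variances, each at most E y_k^4. *)
Lemma lacunary_variance_sqr (s : R) : \sum_(k < u) \int[mu]_t (y k t ^+ 4) <= s ^+ 2 ->
  \int[mu]_t ((V t - v) ^+ 2) <= s ^+ 2.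
Proof.
apply: le_trans; pose f k t := y k t ^+ 2 - \int[mu]_t (y k t ^+ 2).
have fM k : (k < u)%N -> rfreqs_in (M k) (f k).
  move=> ku; rewrite /rfreqs_in; under eq_fun do rewrite rmorphB/=.
  rewrite (_ : (fun t => _) =
    fun t => (y k t ^+ 2)%:C%C + (- \int[mu]_t (y k t ^+ 2))%:C%C); last first.
    by apply/funext => t; rewrite rmorphN.
  by apply: freqs_inD; [exact: y2M|apply: freqs_in_cst; exact: lacM.1].
have y2 (k : 'I_u) : bmeas (fun t => y k t ^+ 2) by exact: bmeasX.
under eq_Rintegral do rewrite -sumrB.
rewrite (@expect_lacunary_sum_sqr _ _ _ _ lacM f)//; last first.
  move=> k ku; rewrite expectB ?expect_cst ?subrr//; last exact: bmeas_cst.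
  exact: (y2 (Ordinal ku)).
apply: ler_sum => k _; rewrite /f; set c := \int[mu]_t (y k t ^+ 2).
under [leLHS]eq_Rintegral do rewrite sqrrB -exprM -[_ *+ 2]mulr_natl [_ ^+ 2 * _]mulrC mulrA.
rewrite expectD ?expectB ?expectZ ?expect_cst//; try by
  [exact: bmeasX|exact: bmeas_cst|exact: bmeasZ|
   apply: bmeasB; [exact: bmeasX|exact: bmeasZ]].
rewrite -/c; have := sqr_ge0 c; rewrite (_ : (2 * 2)%N = 4%N)//; nra.
Qed.

(** The factors 1 + i y_k have mean 1 and multiply like independent variables. *)
Lemma lacunary_product_mean : cexpectation Q = 1.
Proof.
rewrite (@cexpectation_lacunary_prod _ _ _ _ lacM (fun k t => Complex 1 (y k t))).
  apply: big1 => k _; apply: complex_eq; rewrite /= ?expect_cst ?y0//.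
move=> k ku.
rewrite (_ : (fun t => _) = fun t => 1 + 'i%C * (y k t)%:C%C).
  by apply: freqs_inD; [apply: freqs_in_cst; exact: lacM.1|apply: freqs_inZ; exact: yM].
by apply/funext => t; apply: complex_eq; rewrite ?ReD ?ImD ?ReM ?ImM /=; ring.
Qed.

Let normcQ2 t : normc (Q t) ^+ 2 = \prod_(k < u) (1 + y k t ^+ 2).
Proof.
rewrite /Q; elim: u => [|w ih].
  by rewrite !big_ord0 ComplexField.Normc.normc1 expr1n.
by rewrite !big_ord_recr/= ComplexField.Normc.normcM exprMn ih normc_1Di.
Qed.

Let normcQ t : normc (Q t) <= expR (V t / 2).
Proof.
rewrite /Q /V; elim: u => [|w ih].
  by rewrite !big_ord0 ComplexField.Normc.normc1 mul0r expR0.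
rewrite !big_ord_recr/= ComplexField.Normc.normcM mulrDl expRD.
by rewrite ler_pM ?normc_ge0// normc_1Di_le.
Qed.

(* |Q|^2 is the product of the 1 + y_k^2, whose mean is multiplicative too and
   hence at most e^v. *)
Let meanQ2 : \int[mu]_t ((normc (Q t) * expR (- (v / 2))) ^+ 2) <= 1.
Proof.
under eq_Rintegral do rewrite exprMn normcQ2 mulrC -expRM_natl.
have -> : 2%:R * - (v / 2) = - v by field.
have y2 (k : 'I_u) : bmeas (fun t => y k t ^+ 2) by exact: bmeasX.
have h1 k : (k < u)%N -> rfreqs_in (M k) (fun t => 1 + y k t ^+ 2).
  move=> ku; rewrite /rfreqs_in; under eq_fun do rewrite rmorphD/=.
  by apply: freqs_inD; [apply: freqs_in_cst; exact: lacM.1|exact: y2M].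
rewrite expectZ; last first.
  rewrite (_ : (fun t => _) = fun t => normc (Q t) ^+ 2).
    by apply: bmeasX; exact: bmeas_normc.
  by apply/funext => t; rewrite normcQ2.
rewrite (@expect_lacunary_prod _ _ _ _ lacM (fun k t => 1 + y k t ^+ 2))//.
rewrite expRN mulrC ler_pdivrMr ?expR_gt0// mul1r /v expR_sum.
apply: ler_prod => k _.
rewrite expectD//; [|exact: bmeas_cst]; rewrite expect_cst expR_ge1Dx andbT.
by rewrite addr_ge0// Rintegral_ge0// => t _; exact: sqr_ge0.
Qed.

(** Replacing each e^(i y_k) by its Gaussian factor costs 3 |y_k|^3 and gives
    Q e^(-V/2). If V were replaced by v the mean would be exactly e^(-v/2), because
    Q has mean 1; the cost of that replacement is controlled by
    [gauss_replace], using that |Q| e^(-v/2) has L^2 norm at most 1 and that V - v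
    has L^2 norm at most s. *)
Lemma lacunary_characteristic_function (s : R) : 0 <= s ->
  \sum_(k < u) \int[mu]_t (y k t ^+ 4) <= s ^+ 2 ->
  normc (cexpectation (fun t => expi (\sum_(k < u) y k t)) - (expR (- (v / 2)))%:C%C) <=
  6 * \sum_(k < u) \int[mu]_t (`|y k t| ^+ 3) + 4 * s.
Proof.
move=> s0 ys.
pose G t := \prod_(k < u) gauss_factor (y k t).
have GE t : G t = Q t * (expR (- (V t / 2)))%:C%C.
  rewrite /G big_split/= /V mulr_suml -sumrN expR_sum rmorph_prod//.
have Gmeas : cbmeas G.
  rewrite (_ : G = fun t => Q t * (expR (- (V t / 2)))%:C%C); last exact/funext.
  apply: cbmeasM => //; apply: cbmeas_real; apply: bmeas_expR; apply: bmeasN.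
  by apply: bmeasM => //; exact: bmeas_cst.
pose H t := (expR (- (v / 2)))%:C%C * Q t.
have Hmeas : cbmeas H by apply: cbmeasM => //; exact: cbmeas_cst.
have HE : cexpectation H = (expR (- (v / 2)))%:C%C.
  by rewrite /H cexpectationZ// lacunary_product_mean mulr1.
have Zmeas : cbmeas (fun t => expi (\sum_(k < u) y k t)).
  apply: cbmeas_expi; have [] // : bmeas (fun t => \sum_(k < u) y k t).
  by apply: bmeas_sum => k _.
rewrite -HE (_ : _ - _ =
    cexpectation (fun t => expi (\sum_(k < u) y k t) - G t) +
    cexpectation (fun t => G t - H t)); last first.
  by rewrite !cexpectationB//; ring.
rewrite (le_trans (le_normcD _ _))// lerD//.
  apply: le_trans (normc_cexpectation_le (h := fun t => \sum_(k < u) 3 * `|y k t| ^+ 3) _ _ _) _.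
  - exact: cbmeasB.
  - by apply: bmeas_sum => k _; apply: bmeasZ; apply: bmeasX; exact: bmeas_norm.
  - move=> t; rewrite (expi_sum u (fun k => y k t)).
    apply: le_trans (@normc_prod_sub_le R u (fun k => expi (y k t))
      (fun k => gauss_factor (y k t)) _ _) _.
    + by move=> k; rewrite normc_expi.
    + by move=> k; exact: normc_gauss_factor.
    + by apply: ler_sum => k _; exact: expi_gauss_factor.
  - have y3 (k : 'I_u) : bmeas (fun t => `|y k t| ^+ 3) by apply: bmeasX; exact: bmeas_norm.
    rewrite (@expect_sum _ _ _ _ _ _ (fun (k : 'I_u) t => 3 * `|y k t| ^+ 3)).
      under eq_bigr do rewrite expectZ//.
      by rewrite -mulr_sumr mulrA -natrM.
    by move=> k; exact: bmeasZ.
have Vv : bmeas (fun t => V t - v) by apply: bmeasB => //; exact: bmeas_cst.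
have Qv : bmeas (fun t => normc (Q t) * expR (- (v / 2))).
  by apply: bmeasM; [exact: bmeas_normc|exact: bmeas_cst].
apply: le_trans (normc_cexpectation_le
  (h := fun t => `|V t - v| + `|(V t - v) * (normc (Q t) * expR (- (v / 2)))|) _ _ _) _.
- exact: cbmeasB.
- by apply: bmeasD; apply: bmeas_norm => //; exact: bmeasM.
- move=> t; rewrite GE /H [_ * Q t]mulrC -mulrBr ComplexField.Normc.normcM.
  rewrite -rmorphB normc_real; apply: gauss_replace => //; exact: normc_ge0.
- rewrite expectD; [|exact: bmeas_norm|by apply: bmeas_norm; exact: bmeasM].
  have vs := lacunary_variance_sqr ys.
  have c1 : \int[mu]_t `|V t - v| <= s * 1.
    under eq_Rintegral do rewrite -[V _ - v]mulr1.
    apply: expect_CauchySchwarz => //; first exact: bmeas_cst.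
    by rewrite expect_cst.
  have c2 : \int[mu]_t `|(V t - v) * (normc (Q t) * expR (- (v / 2)))| <= s * 1.
    by apply: expect_CauchySchwarz => //; rewrite expr1n.
  lra.
Qed.

End lacunary_characteristic_function.

(** * Blocks and gaps *)

Section block_partition.
Variable R : realType.
Variables (n P q w : nat).
Hypothesis qP : (2 * q <= P)%N.
Hypothesis P0 : (0 < P)%N.
Hypothesis wn : (w * P < n)%N.
Hypothesis nw : (n <= w * P + P)%N.

(* The first w periods of length P end with a gap of length q; the last, possibly
   shorter, period is a block without gap. *)
Definition block_start k := (k * P).+1.
Definition block_end k := if (k < w)%N then (k * P + P - q)%N else n.
Definition gap_start k := (k * P + P - q).+1.
Definition gap_end k := (k * P + P)%N.

Lemma leq_mulwP k : (k < w)%N -> (k * P + P <= w * P)%N.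
Proof using Type. by move=> kw; rewrite addnC -mulSn leq_mul2r kw orbT. Qed.

Lemma block_bounds k : (k < w.+1)%N ->
  (1 <= block_start k <= block_end k)%N /\ (block_end k <= n)%N.
Proof using qP P0 wn.
rewrite ltnS leq_eqVlt /block_start /block_end => /predU1P[->|kw].
  by rewrite ltnn wn leqnn.
by rewrite kw; have := leq_mulwP kw; clear nw; lia.
Qed.

Lemma block_gap k : (k.+1 < w.+1)%N ->
  (block_end k + q.+1 <= block_start k.+1)%N.
Proof using qP.
by rewrite ltnS /block_start /block_end mulSn => kw; rewrite kw; clear P0 wn nw; lia.
Qed.

Lemma gap_bounds k : (0 < q)%N -> (k < w)%N ->
  (1 <= gap_start k <= gap_end k)%N /\ (gap_end k <= n)%N.
Proof using qP wn.
move=> q0 kw; rewrite /gap_start /gap_end; have := leq_mulwP kw.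
clear P0 nw; lia.
Qed.

(** Two gaps are separated by a block of length P - q >= q. *)
Lemma gap_gap k : (gap_end k + q.+1 <= gap_start k.+1)%N.
Proof using qP. by rewrite /gap_start /gap_end mulSn; clear P0 wn nw; lia. Qed.

Lemma block_length k : (k < w.+1)%N -> ((block_end k).+1 - block_start k <= P)%N.
Proof using nw.
rewrite ltnS leq_eqVlt /block_start /block_end => /predU1P[->|kw].
  by rewrite ltnn; clear qP P0 wn; lia.
by rewrite kw; clear qP P0 wn nw; lia.
Qed.

Lemma gap_length k : ((gap_end k).+1 - gap_start k = q)%N.
Proof using qP. by rewrite /gap_start /gap_end; clear P0 wn nw; lia. Qed.

Lemma block_gap_split (f : nat -> R) :
  \sum_(1 <= l < n.+1) f l =
  \sum_(k < w.+1) \sum_(block_start k <= l < (block_end k).+1) f l +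
  \sum_(k < w) \sum_(gap_start k <= l < (gap_end k).+1) f l.
Proof using qP wn.
rewrite big_ord_recr/= addrAC.
have -> : \sum_(1 <= l < n.+1) f l =
    \sum_(1 <= l < (w * P).+1) f l + \sum_((w * P).+1 <= l < n.+1) f l.
  by rewrite -big_cat_nat//= ltnS ltnW.
congr (_ + _); last by rewrite /block_start /block_end ltnn.
rewrite -big_split/=.
suff H K : (K <= w)%N -> \sum_(1 <= l < (K * P).+1) f l =
    \sum_(k < K) (\sum_(block_start k <= l < (block_end k).+1) f l +
                  \sum_(gap_start k <= l < (gap_end k).+1) f l) by exact: H.
elim: K => [|K ih] Kw; first by rewrite big_geq// big_ord0.
rewrite big_ord_recr/= -ih 1?ltnW// /block_start /block_end Kw /gap_start /gap_end.
rewrite mulSn addnC (@big_cat_nat _ _ _ (K * P).+1)//=; last by rewrite ltnS leq_addr.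
by congr (_ + _); rewrite (@big_cat_nat _ _ _ (K * P + P - q).+1)//=; clear P0 wn nw; lia.
Qed.

End block_partition.

Section block_estimate.
Variables (R : realType) (d n P q w : nat) (A : nat -> 'M[int]_d).
Variables (D Delta G : R) (g : d.-tuple R -> R).
Local Notation mu := (torus_measure R d).
Local Notation normc := (@ComplexField.Normc.normc R).
Hypothesis detA : forall k, (1 <= k <= n)%N -> \det (A k) = 1.
Hypothesis AS : propS n A D Delta.
Hypothesis D0 : 0 <= D.
Hypothesis Deltaq : Delta <= q.+1%:R.
Hypothesis gD : rfreqs_in (low_freqs D) g.
Hypothesis g0 : \int[mu]_t g t = 0.
Hypothesis gG : forall t, `|g t| <= G.
Hypothesis qP : (2 * q <= P)%N.
Hypothesis P0 : (0 < P)%N.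
Hypothesis wn : (w * P < n)%N.
Hypothesis nw : (n <= w * P + P)%N.

Let G0 : 0 <= G.
Proof. exact: le_trans (normr_ge0 _) (gG [tuple of nseq d 0]). Qed.

Let a := block_start P.
Let b := block_end n P q w.
Let T k := block_sum A g (a k) (b k).
Let U k := block_sum A g (gap_start P q k) (gap_end P k).
Let S := birkhoff_sum A g n.
Let W t := \sum_(k < w) U k t.

Let SE t : S t = \sum_(k < w.+1) T k t + W t.
Proof. exact: (block_gap_split qP wn). Qed.

Let blocks_bmeas k1 k2 : bmeas (block_sum A g k1 k2).
Proof. exact: rfreqs_in_bmeas (rfreqs_in_orbit_freqs A k1 k2 gD). Qed.

Let S_bmeas : bmeas S.
Proof. exact: blocks_bmeas. Qed.

Let W_bmeas : bmeas W.
Proof. by apply: bmeas_sum => k _; exact: blocks_bmeas. Qed.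

Let block_sum_le (k1 k2 m : nat) t : (k2.+1 - k1 <= m)%N ->
  `|block_sum A g k1 k2 t| <= m%:R * G.
Proof.
move=> km; rewrite (le_trans (ler_norm_sum _ _ _))//.
apply: (@le_trans _ _ (\sum_(k1 <= l < k2.+1) G)); first exact: ler_sum.
by rewrite sumr_const_nat -[leLHS]mulr_natl ler_wpM2r// ler_nat.
Qed.

Let lacT : lacunary w.+1 (fun k => block_freqs A D (a k) (b k)).
Proof.
apply: (lacunary_blocks AS D0 Deltaq); first exact: block_bounds.
exact: block_gap.
Qed.

Let ET0 k : (k < w.+1)%N -> \int[mu]_t T k t = 0.
Proof.
move=> kw; have [_ bn] := block_bounds qP P0 wn kw.
apply: (@expect_block_sum _ _ A D g (a k) (b k)) => // j /andP[j1 jb].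
by rewrite detA// j1 (leq_trans jb).
Qed.

(* The gaps are at least Delta apart, like the blocks, so their frequency
   sets are lacunary and the gap sums are orthogonal. Without gaps W vanishes. *)
Let EW2 : \int[mu]_t (W t ^+ 2) <= w%:R * (q%:R * G) ^+ 2.
Proof.
have U2 k : \int[mu]_t (U k t ^+ 2) <= (q%:R * G) ^+ 2.
  rewrite -[leRHS](expect_cst mu); apply: expect_le => [||t].
  - exact/bmeasX/blocks_bmeas.
  - exact: bmeas_cst.
  - rewrite -(real_normK (num_real (U k t))) ler_sqr ?nnegrE ?mulr_ge0//.
    by apply: block_sum_le; rewrite gap_length.
have [q0|q0] := posnP q.
  have -> : W = fun=> 0.
    apply/funext => t; apply: big1 => k _.
    by rewrite /U /block_sum big_geq// /gap_end /gap_start q0 subn0.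
  by rewrite expr0n/= expect_cst q0 mul0r expr0n/= mulr0.
have lacU : lacunary w (fun k => block_freqs A D (gap_start P q k) (gap_end P k)).
  apply: (lacunary_blocks AS D0 Deltaq) => k kw; first exact: (gap_bounds qP wn q0 kw).
  exact: gap_gap.
rewrite (expect_lacunary_sum_sqr lacU) => [|k kw|k kw].
- apply: (@le_trans _ _ (\sum_(k < w) (q%:R * G) ^+ 2)); first exact: ler_sum.
  by rewrite sumr_const card_ord -[leLHS]mulr_natl.
- apply: rfreqs_in_block_sum => //.
  by have [/andP[]] := gap_bounds qP wn q0 kw.
- have [_ bn] := gap_bounds qP wn q0 kw.
  apply: (@expect_block_sum _ _ A D g _ _) => // j /andP[j1 jb].
  by rewrite detA// j1 (leq_trans jb).
Qed.

(** The three terms come from discarding the gap sum W, from the Gaussian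
    approximation of the block sums, and from comparing the variance
    E (S - W)^2 of the block sums with N^2 = E S^2 by means of Cauchy-Schwarz. *)
Lemma block_characteristic_bound (N x s om : R) :
  0 < N -> N ^+ 2 = \int[mu]_t (S t ^+ 2) -> 0 <= s -> 0 <= om ->
  w.+1%:R * (`|x| / N * (P%:R * G)) ^+ 4 <= s ^+ 2 ->
  w%:R * (q%:R * G) ^+ 2 <= om ^+ 2 ->
  normc (cexpectation (fun t => expi (x * (S t / N))) -
         (expR (- (2^-1 * x ^+ 2)))%:C%C) <=
  4 * (`|x| / N) * om +
  (6 * (w.+1%:R * (`|x| / N * (P%:R * G)) ^+ 3) + 4 * s) +
  (`|x| / N) ^+ 2 * (N * om + om ^+ 2 / 2).
Proof.
move=> N0 N2 s0 om0 hs hom.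
set z := `|x| / N; have z0 : 0 <= z by rewrite divr_ge0// ltW.
set c := x / N.
have cz : `|c| = z by rewrite normrM normfV [`|N|]gtr0_norm.
have EW : \int[mu]_t (W t ^+ 2) <= om ^+ 2 by exact: le_trans EW2 hom.
pose y k t := c * T k t.
have y_bmeas k : bmeas (y k) by apply: bmeasZ; exact: blocks_bmeas.
have yM k : (k < w.+1)%N -> rfreqs_in (block_freqs A D (a k) (b k)) (y k).
  move=> kw; apply: rfreqs_inZ; apply: rfreqs_in_block_sum => //.
  by have [/andP[]] := block_bounds qP P0 wn kw.
have y2M k : (k < w.+1)%N ->
    rfreqs_in (block_freqs A D (a k) (b k)) (fun t => y k t ^+ 2).
  move=> kw; rewrite (_ : (fun t => _) = fun t => c ^+ 2 * T k t ^+ 2).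
    by apply: rfreqs_inZ; exact: rfreqs_in_block_sum_sqr.
  by apply/funext => t; rewrite exprMn.
have Ey0 k : (k < w.+1)%N -> \int[mu]_t y k t = 0.
  by move=> kw; rewrite expectZ ?ET0 ?mulr0//; exact: blocks_bmeas.
have yle k t : (k < w.+1)%N -> `|y k t| <= z * (P%:R * G).
  move=> kw; rewrite normrM cz ler_wpM2l// block_sum_le//.
  exact: block_length.
have zPG0 : 0 <= z * (P%:R * G) by apply: mulr_ge0 => //; apply: mulr_ge0.
set v := \sum_(k < w.+1) \int[mu]_t (y k t ^+ 2).
have vE : v = c ^+ 2 * \int[mu]_t ((S t - W t) ^+ 2).
  rewrite /v -(expect_lacunary_sum_sqr lacT yM Ey0) -expectZ.
    apply: eq_Rintegral => t _; rewrite SE addrK -exprMn mulr_sumr//.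
  by apply: bmeasX; exact: bmeasB.
have main := lacunary_characteristic_function lacT yM y2M Ey0 s0.
have y4 : \sum_(k < w.+1) \int[mu]_t (y k t ^+ 4) <= s ^+ 2.
  apply: le_trans hs; rewrite mulr_natl -[w.+1 in leRHS]card_ord -sumr_const.
  apply: ler_sum => k _; rewrite -[leRHS](expect_cst mu).
  apply: expect_le => [||t]; [exact: bmeasX|exact: bmeas_cst|].
  rewrite -(@ger0_norm _ (y k t ^+ 4)) ?exprn_even_ge0// normrX.
  by apply: lerXn2r; rewrite ?nnegrE ?zPG0 ?yle.
have y3 : \sum_(k < w.+1) \int[mu]_t (`|y k t| ^+ 3) <=
    w.+1%:R * (z * (P%:R * G)) ^+ 3.
  rewrite mulr_natl -[w.+1 in leRHS]card_ord -sumr_const.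
  apply: ler_sum => k _; rewrite -[leRHS](expect_cst mu).
  apply: expect_le => [||t]; [by apply: bmeasX; exact: bmeas_norm|exact: bmeas_cst|].
  by apply: lerXn2r; rewrite ?nnegrE ?zPG0 ?yle.
have {}main := main y4; rewrite -/v in main.
have EWabs : \int[mu]_t `|W t| <= om.
  under eq_Rintegral do rewrite -[W _]mulr1.
  rewrite -[leRHS]mulr1; apply: expect_CauchySchwarz => //; first exact: bmeas_cst.
  by rewrite expect_cst.
have EWS : \int[mu]_t `|W t * S t| <= om * N.
  by apply: expect_CauchySchwarz => //; [exact: ltW|rewrite N2].
have Zmeas : cbmeas (fun t => expi (x * (S t / N))).
  apply: cbmeas_expi; case: (bmeasZ x (bmeasM S_bmeas (bmeas_cst _ N^-1))) => //.
have Ymeas : cbmeas (fun t => expi (\sum_(k < w.+1) y k t)).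
  apply: cbmeas_expi; have [] // : bmeas (fun t => \sum_(k < w.+1) y k t).
  by apply: bmeas_sum => k _.
have first_step : normc (cexpectation (fun t => expi (x * (S t / N))) -
    cexpectation (fun t => expi (\sum_(k < w.+1) y k t))) <= 4 * z * om.
  rewrite -cexpectationB//.
  apply: le_trans (normc_cexpectation_le (h := fun t => (2 * z) * `|W t|) _ _ _) _.
  - exact: cbmeasB.
  - by apply: bmeasZ; exact: bmeas_norm.
  - move=> t; rewrite (le_trans (normc_expi_sub _ _))// -mulrA ler_wpM2l//.
    rewrite -cz -normrM -mulr_sumr (_ : _ - _ = c * W t)// SE /c; ring.
  - rewrite expectZ; last exact: bmeas_norm.
    have := ler_wpM2l z0 EWabs; lra.
have last_step : normc ((expR (- (v / 2)))%:C%C - (expR (- (2^-1 * x ^+ 2)))%:C%C) <=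
    z ^+ 2 * (N * om + om ^+ 2 / 2).
  rewrite -rmorphB normc_real [2^-1 * _]mulrC.
  have v0 : 0 <= v by apply: sumr_ge0 => k _; apply: Rintegral_ge0 => t _; exact: sqr_ge0.
  apply: le_trans (expRN_lipschitz _ _) _; [by rewrite divr_ge0|by rewrite divr_ge0 ?sqr_ge0|].
  have xE : x ^+ 2 = c ^+ 2 * N ^+ 2 by rewrite -exprMn /c divfK// gt_eqF.
  have WS_bmeas : bmeas (fun t => W t * S t) by exact: bmeasM.
  have E2 : \int[mu]_t ((S t - W t) ^+ 2) =
      N ^+ 2 + - 2 * \int[mu]_t (W t * S t) + \int[mu]_t (W t ^+ 2).
    rewrite N2 -expectZ// -expectD; [|exact: bmeasX|exact: bmeasZ].
    rewrite -expectD; [|by apply: bmeasD; [exact: bmeasX|exact: bmeasZ]|exact: bmeasX].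
    by apply: eq_Rintegral => t _; ring.
  rewrite vE E2 xE.
  set I1 := \int[mu]_t (W t * S t); set I2 := \int[mu]_t (W t ^+ 2).
  have -> : c ^+ 2 * (N ^+ 2 + - 2 * I1 + I2) / 2 - c ^+ 2 * N ^+ 2 / 2 =
    c ^+ 2 * (- I1 + I2 / 2) by field.
  rewrite normrM normrX cz ler_wpM2l ?sqr_ge0// (le_trans (ler_normD _ _))//.
  rewrite normrN lerD//.
    by rewrite (le_trans (expect_norm _ WS_bmeas))// mulrC.
  rewrite ger0_norm ?ler_pM2r// divr_ge0// Rintegral_ge0// => t _; exact: sqr_ge0.
rewrite (_ : _ - _ = (cexpectation (fun t => expi (x * (S t / N))) -
      cexpectation (fun t => expi (\sum_(k < w.+1) y k t))) +
    (cexpectation (fun t => expi (\sum_(k < w.+1) y k t)) - (expR (- (v / 2)))%:C%C) +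
    ((expR (- (v / 2)))%:C%C - (expR (- (2^-1 * x ^+ 2)))%:C%C)); last by ring.
rewrite (le_trans (le_normcD _ _))// lerD// (le_trans (le_normcD _ _))// lerD//.
rewrite (le_trans main)// lerD2r ler_pM2l//.
Qed.

End block_estimate.

(** * Choice of the block lengths *)

Lemma period_count (n P : nat) : (0 < n)%N -> (0 < P)%N ->
  (n.-1 %/ P * P < n <= n.-1 %/ P * P + P)%N.
Proof.
move=> n0 P0; have := ltn_pmod n.-1 P0; have := divn_eq n.-1 P.
move: (_ %/ _ * _)%N (_ %% _)%N => k r; lia.
Qed.

Section final_estimate.
Variable R : realType.

(** The seven coefficients cover the powers r^2, r^3, r^4 and r^6 of
    r = ||g||_oo^(1/2) that occur in [final_bound], with constants at most 18. *)
Definition bound_poly : {poly R} := \poly_(i < 7) 18.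

Lemma le_bound_poly (r c : R) (k : nat) : 0 <= r -> 0 <= c <= 18 -> (k < 7)%N ->
  c * r ^+ k <= bound_poly.[r].
Proof.
move=> r0 /andP[c0 c18] k7; rewrite horner_poly (bigD1 (Ordinal k7))//=.
by rewrite ler_wpDr ?sumr_ge0// ?ler_wpM2r ?exprn_ge0// => i _; rewrite mulr_ge0 ?exprn_ge0.
Qed.

(** Here z = |x| / N and r^2 bounds |g|. The bound from the variance of the
    squares is 8 r^4 (z j)^2 = 8 r^3 (z j) (r z j), of first order in z j only
    because r z j <= 1. *)
Lemma final_bound (r z x N h B Delta j wR PR : R) : 0 <= r -> 0 <= z ->
  0 < N -> `|x| = z * N -> 0 <= h -> 0 <= Delta -> 0 <= j ->
  0 <= PR <= B -> 0 <= wR <= 3 * h ^+ 2 ->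
  j ^+ 2 = h * B ^+ 2 -> r * z * j <= 1 ->
  4 * z * (2 * h * Delta * r ^+ 2) +
  (6 * (wR * (z * (PR * r ^+ 2)) ^+ 3) + 4 * (2 * j ^+ 2 * r ^+ 4 * z ^+ 2)) +
  z ^+ 2 * (N * (2 * h * Delta * r ^+ 2) + (2 * h * Delta * r ^+ 2) ^+ 2 / 2) <=
  bound_poly.[r] * (z * Delta * h + z ^+ 3 * (h ^+ 2 * B ^+ 3) + z * j
    + `|x| * z * h * Delta + z ^+ 2 * h ^+ 2 * Delta ^+ 2).
Proof.
move=> r0 z0 N0 xz h0 Delta0 j0 /andP[P0 PB] /andP[w0 wh] jj rzj.
have b := le_bound_poly r0.
set C := bound_poly.[r] in b *.
have b2 := b 8 2%N; have b3 := b 8 3%N; have b4 := b 2 4%N; have b6 := b 18 6%N.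
have b2' := b 2 2%N.
pose t1 := z * Delta * h; pose t2 := z ^+ 3 * (h ^+ 2 * B ^+ 3); pose t3 := z * j.
pose t4 := `|x| * z * h * Delta; pose t5 := z ^+ 2 * h ^+ 2 * Delta ^+ 2.
have B0 : 0 <= B by exact: le_trans PB.
have t10 : 0 <= t1 by rewrite !mulr_ge0.
have t20 : 0 <= t2 by rewrite !mulr_ge0 ?exprn_ge0.
have t30 : 0 <= t3 by rewrite !mulr_ge0.
have t40 : 0 <= t4 by rewrite !mulr_ge0.
have t50 : 0 <= t5 by rewrite !mulr_ge0 ?exprn_ge0.
rewrite -/t1 -/t2 -/t3 -/t4 -/t5 !mulrDr.
have e1 : 4 * z * (2 * h * Delta * r ^+ 2) <= C * t1.
  rewrite (_ : _ * _ = 8 * r ^+ 2 * t1); last by rewrite /t1; ring.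
  by rewrite ler_wpM2r// b2//; lra.
have e2 : 6 * (wR * (z * (PR * r ^+ 2)) ^+ 3) <= C * t2.
  apply: (@le_trans _ _ (18 * r ^+ 6 * t2)); last first.
    by rewrite ler_wpM2r// b6//; lra.
  rewrite (_ : 6 * _ = 6 * (z ^+ 3 * r ^+ 6) * (wR * PR ^+ 3)); last by ring.
  rewrite (_ : _ * t2 = 6 * (z ^+ 3 * r ^+ 6) * (3 * h ^+ 2 * B ^+ 3)); last by rewrite /t2; ring.
  apply: ler_wpM2l; first by rewrite !mulr_ge0 ?exprn_ge0.
  by rewrite ler_pM ?exprn_ge0// lerXn2r ?nnegrE.
have e3 : 4 * (2 * j ^+ 2 * r ^+ 4 * z ^+ 2) <= C * t3.
  apply: (@le_trans _ _ (8 * r ^+ 3 * t3)); last first.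
    by rewrite ler_wpM2r// b3//; lra.
  rewrite (_ : 4 * _ = 8 * r ^+ 3 * t3 * (r * z * j)); last by rewrite /t3; ring.
  by rewrite ler_piMr// !mulr_ge0 ?exprn_ge0.
have e4 : z ^+ 2 * (N * (2 * h * Delta * r ^+ 2)) <= C * t4.
  rewrite (_ : _ * _ = 2 * r ^+ 2 * t4); last by rewrite /t4 xz; ring.
  by rewrite ler_wpM2r// b2'//; lra.
have e5 : z ^+ 2 * ((2 * h * Delta * r ^+ 2) ^+ 2 / 2) <= C * t5.
  rewrite (_ : _ * _ = 2 * r ^+ 4 * t5); last by rewrite /t5; field.
  by rewrite ler_wpM2r// b4//; lra.
lra.
Qed.

End final_estimate.

Theorem lemma1p4 (R : realType) (d : nat) (hd : (2 <= d)%N) :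
  exists C : {poly R},
    C != 0 /\ (forall i : nat, (i < size C)%N -> 0 < C`_i) /\
    forall (n : nat) (A : nat -> 'M[int]_d) (beta Dn Deltan : R)
           (g : d.-tuple R -> R),
      (1 <= n)%N ->
      (forall k : nat, (1 <= k <= n)%N -> \det (A k) = 1) ->
      0 < beta < 1 ->
      0 < Dn ->
      0 < Deltan ->
      Deltan < 2^-1 * n%:R `^ beta ->
      propS n A Dn Deltan ->
      real_trig_poly g ->
      ('E_(torus_measure R d)[g] = 0)%E ->
      (forall p : 'cV[int]_d, Dn < (max_norm p)%:R -> fourier_coef g p = 0) ->
      let Sn := birkhoff_sum A g n in
      let normS := L2_norm Sn in
      let normg := sup_norm g in
      0 < normS ->
      forall x : R,
        `|x| * normg * n%:R `^ beta <= normS ->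
        `|x| * normg `^ (2^-1) * n%:R `^ ((1 + 3 * beta) / 4) <= normS ->
        ComplexField.Normc.normc
          (cexpectation (fun t : d.-tuple R => expi (x * (Sn t / normS)))
           - (expR (- (2^-1 * x ^+ 2)))%:C%C)
        <= C.[normg `^ (2^-1)] *
           (`|x| * normS^-1 * Deltan * n%:R `^ ((1 - beta) / 2)
            + `|x| ^+ 3 * normS ^- 3 * n%:R `^ (1 + 2 * beta)
            + `|x| * normS^-1 * n%:R `^ ((1 + 3 * beta) / 4)
            + `|x| ^+ 2 * normS^-1 * n%:R `^ ((1 - beta) / 2) * Deltan
            + `|x| ^+ 2 * normS ^- 2 * n%:R `^ (1 - beta) * Deltan ^+ 2).
Proof.
exists (bound_poly R); split; last split.
- apply/eqP => /(congr1 (fun p : {poly R} => p`_0)).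
  by rewrite coef_poly coef0 => /eqP; rewrite pnatr_eq0.
- move=> i iC; have i7 : (i < 7)%N by apply: leq_trans iC (size_poly _ _).
  by rewrite coef_poly i7.
move=> n A beta Dn Deltan g n1 detA /andP[beta0 beta1] Dn0 Delta0 DeltaB AS gtrig Eg gDn.
move=> Sn normS normg N0 x _ hx2.
have gD := rfreqs_in_real_trig_poly gtrig gDn.
have gmeas := rfreqs_in_bmeas gD.
have g0 : \int[torus_measure R d]_t g t = 0.
  by move: Eg; rewrite unlock /Rintegral => ->.
have gG t : `|g t| <= normg by exact: normr_le_sup_norm.
have G0 : 0 <= normg by exact: le_trans (normr_ge0 _) (gG [tuple of nseq d 0]).
have nR0 : n%:R != 0 :> R by rewrite pnatr_eq0 -lt0n.
have nR1 : 1 <= n%:R :> R by rewrite ler1n.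
have powD (s t : R) : n%:R `^ (s + t) = n%:R `^ s * n%:R `^ t.
  by rewrite powRD// nR0 implybT.
set B := n%:R `^ beta in DeltaB *; set h := n%:R `^ ((1 - beta) / 2).
set j := n%:R `^ ((1 + 3 * beta) / 4) in hx2 *; set r := normg `^ 2^-1 in hx2 *.
have B1 : 1 <= B by rewrite -(powRr0 n%:R) ler_powR// ltW.
have h1 : 1 <= h by rewrite -(powRr0 n%:R) ler_powR// divr_ge0// subr_ge0 ltW.
have h2 : n%:R `^ (1 - beta) = h ^+ 2.
  by rewrite expr2 -powD; congr (_ `^ _); field.
have hB : n%:R = B * h ^+ 2 :> R.
  by rewrite -h2 -powD -[LHS]powRr1//; congr (_ `^ _); ring.
have hB3 : n%:R `^ (1 + 2 * beta) = h ^+ 2 * B ^+ 3.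
  by rewrite -h2 !exprS expr0 mulr1 -!powD; congr (_ `^ _); ring.
have jj : j ^+ 2 = h * B ^+ 2.
  by rewrite !expr2 -!powD; congr (_ `^ _); field.
have r2 : r ^+ 2 = normg by rewrite -powR_mulrn ?powR_ge0// -powRrM mulVf// powRr1.
have r0 : 0 <= r by exact: powR_ge0.
have j0 : 0 <= j by exact: powR_ge0.
(* Periods of length floor (n^beta), gaps of length floor Delta. *)
pose P := Num.truncn B.
have /andP[PB BP] := truncn_itv (le_trans ler01 B1); rewrite -/P in PB BP.
have P0 : (0 < P)%N by rewrite -ltnS -(ltr_nat R); exact: le_lt_trans B1 BP.
pose q := Num.truncn Deltan.
have /andP[qD /ltW Dq] := truncn_itv (ltW Delta0); rewrite -/q in qD Dq.
have qP : (2 * q <= P)%N.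
  by rewrite -ltnS -(ltr_nat R) natrM; lra.
pose w := (n.-1 %/ P)%N; have /andP[wn nw] := period_count n1 P0.
rewrite -/w in wn nw.
(* P is at least B / 2, hence w <= n / P <= 2 n / B = 2 h ^ 2. *)
have w3 : w.+1%:R <= 3 * h ^+ 2.
  have wPn : w%:R * P%:R <= n%:R :> R by rewrite -natrM ler_nat ltnW.
  have P1 : 1 <= P%:R :> R by rewrite ler1n.
  have BP2 : B <= 2 * P%:R by move: BP; rewrite -(natr1 P); lra.
  have hh : 1 <= h ^+ 2 by rewrite exprn_ege1.
  have : w%:R * B <= 2 * h ^+ 2 * B.
    have := ler_wpM2l (ler0n R w) BP2; rewrite hB in wPn; lra.
  rewrite ler_pM2r; last lra.
  by rewrite -(natr1 w); lra.
have [z zE] : exists z, z = `|x| / normS by exists (`|x| / normS).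
have z0 : 0 <= z by rewrite zE divr_ge0// ltW.
have xz : `|x| = z * normS by rewrite zE divfK// gt_eqF.
have Smeas : bmeas Sn by exact: (rfreqs_in_bmeas (rfreqs_in_orbit_freqs A 1 n gD)).
have := @block_characteristic_bound R d n P q w A Dn Deltan normg g detA AS
  (ltW Dn0) Dq gD g0 gG qP P0 wn nw normS x (2 * j ^+ 2 * r ^+ 4 * z ^+ 2)
  (2 * h * Deltan * r ^+ 2) N0 (L2_norm_sqr Smeas).
rewrite -r2 -zE => main; apply: le_trans (main _ _ _ _) _ => {main}.
- by rewrite !mulr_ge0 ?exprn_ge0.
- by rewrite !mulr_ge0 ?exprn_ge0// ?ltW//; lra.
- have -> : (2 * j ^+ 2 * r ^+ 4 * z ^+ 2) ^+ 2 = 4 * h ^+ 2 * (z * (B * r ^+ 2)) ^+ 4.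
    by rewrite jj; ring.
  rewrite ler_pM ?exprn_ge0 ?mulr_ge0 ?exprn_ge0//.
    by have := sqr_ge0 h; lra.
  rewrite lerXn2r ?nnegrE ?mulr_ge0 ?exprn_ge0//; first lra.
  by rewrite ler_wpM2l// ler_wpM2r ?exprn_ge0.
- have -> : (2 * h * Deltan * r ^+ 2) ^+ 2 = 4 * h ^+ 2 * (Deltan * r ^+ 2) ^+ 2 by ring.
  rewrite ler_pM ?exprn_ge0 ?mulr_ge0 ?exprn_ge0//.
    by move: w3; rewrite -(natr1 w); have := sqr_ge0 h; lra.
  rewrite lerXn2r ?nnegrE ?mulr_ge0 ?exprn_ge0//; first exact: ltW.
  by rewrite ler_wpM2r ?exprn_ge0.
rewrite (_ : _ + _ + _ + _ + _ =
  z * Deltan * h + z ^+ 3 * (h ^+ 2 * B ^+ 3) + z * j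
    + `|x| * z * h * Deltan + z ^+ 2 * h ^+ 2 * Deltan ^+ 2); last first.
  by rewrite hB3 h2 xz; field; rewrite gt_eqF.
apply: final_bound => //.
- lra.
- lra.
- by rewrite ler0n.
- by rewrite ler0n.
- rewrite (_ : r * z * j = `|x| * r * j / normS); last by rewrite zE; field; rewrite gt_eqF.
  by rewrite ler_pdivrMr// mul1r.
Qed.
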